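(* Let $\varrho$ be a primitive substitution of constant length on a compact Hausdorff alphabet $\mathcal{A}$ that contains an isolated point, with substitution operator $M$, spectral radius $r$ of $M$, and $T=M/r$. Then $T$ is quasi-compact, and the subshift $(X_\varrho,\sigma)$ is uniquely ergodic.
   Context: $\mathcal{A}$ is a compact Hausdorff space; $\mathcal{A}^+=\bigsqcup_{n\ge1}\mathcal{A}^n$ is the space of non-empty finite words (disjoint union of product topologies), $\mathcal{A}^*=\mathcal{A}^+\sqcup\{\varepsilon\}$. A substitution is a continuous map $\varrho\colon\mathcal{A}\to\mathcal{A}^+$, extended to words by concatenation and iterated; it has constant length if $|\varrho(a)|$ is the same for all $a\in\mathcal{A}$. Standing assumption: $|\varrho(a)|\ge2$ for some $a$. Primitive: for every non-empty open $U\subseteq\mathcal{A}$ there is $p\ge0$ such that for all $a\in\mathcal{A}$ some letter of $\varrho^p(a)$ is in $U$. $E=C(\mathcal{A})$ (continuous real functions, supremum norm); $(Mf)(a)=\sum_{b\triangleleft\varrho(a)}f(b)$, summing over all letters of $\varrho(a)$ with multiplicity. $T$ (which has spectral radius $1$) is quasi-compact if there are a compact operator $C$ on $E$ and an integer $n\ge1$ with $\|T^n-C\|<1$. A word is generated by $\varrho$ if it is a subword of some $\varrho^k(a)$, $a\in\mathcal{A}$, $k\ge0$; $\mathcal{L}(\varrho)\subseteq\mathcal{A}^*$ is the closure of the set of generated words; $X_\varrho\subseteq\mathcal{A}^{\mathbb{Z}}$ (product topology) is the set of bi-infinite sequences all of whose finite subwords lie in $\mathcal{L}(\varrho)$, with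 shift $\sigma(x)_i=x_{i+1}$. Uniquely ergodic means there is exactly one $\sigma$-invariant regular Borel probability measure. *)

(* Defs.v *)
From HB Require Import structures.
From mathcomp Require Import all_boot all_order all_algebra.
From mathcomp Require Import all_classical all_reals all_analysis.
From mathcomp Require Import complex.

Set Implicit Arguments.
Unset Strict Implicit.
Unset Printing Implicit Defensive.

Import Order.TTheory GRing.Theory Num.Theory.
Import numFieldNormedType.Exports.

Local Open Scope classical_set_scope.
Local Open Scope ring_scope.

Definition word_of_length (A : topologicalType) (n : nat) : topologicalType :=
  prod_topology (fun _ : 'I_n => A).

(* word_of_length A 0 has a single point, the empty word. *)
Definition word (A : topologicalType) : topologicalType :=
  {n : nat & word_of_length A n}.

(* The index n stands for the length n.+1. *)
Definition nword (A : topologicalType) : topologicalType :=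
  {n : nat & word_of_length A n.+1}.

Definition letters (A : topologicalType) (n : nat) (w : word_of_length A n) :
    seq A :=
  [seq w i | i : 'I_n].

Section substitution.
Context (A : topologicalType) (rho : continuousType A (nword A)).

Definition subst_letter (a : A) : seq A := letters (projT2 (rho a)).

Definition subst_word (s : seq A) : seq A :=
  flatten [seq subst_letter a | a <- s].

Definition constant_length : Prop :=
  forall a b : A, size (subst_letter a) = size (subst_letter b).

Definition growing : Prop :=
  exists a : A, (2 <= size (subst_letter a))%N.

Definition primitive : Prop :=
  forall U : set A, open U -> U !=set0 ->
  exists p : nat, forall a : A,
  exists2 b : A, b \in iter p subst_word [:: a] & U b.

Definition generated (s : seq A) : Prop :=
  exists (a : A) (k : nat), infix s (iter k subst_word [:: a]).

Definition language : set (word A) :=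
  closure [set w : word A | generated (letters (projT2 w))].

End substitution.

Definition biinfinite (A : topologicalType) : topologicalType :=
  prod_topology (fun _ : int => A).

Definition full_shift (A : topologicalType) (x : biinfinite A) : biinfinite A :=
  fun i : int => x (i + 1).

(* The word x_i x_(i+1) ... x_(i+n-1). *)
Definition subword (A : topologicalType) (x : biinfinite A) (i : int)
    (n : nat) : word A :=
  existT (word_of_length A) n (fun j : 'I_n => x (i + (j : nat)%:Z)).

Definition subshift (A : topologicalType) (rho : continuousType A (nword A)) :
    set (biinfinite A) :=
  [set x | forall (i : int) (n : nat), language rho (subword x i n)].

Lemma shift_subshift (A : topologicalType) (rho : continuousType A (nword A))
    (x : biinfinite A) :
  subshift rho x -> subshift rho (full_shift x).
Proof.
move=> Xx i n.
suff -> : subword (full_shift x) i n = subword x (i + 1) n by exact: Xx.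
by congr existT; apply/funext => j; rewrite /full_shift addrAC.
Qed.

(* set_type carries the subspace topology. *)
Definition subshift_type (A : topologicalType)
    (rho : continuousType A (nword A)) : topologicalType :=
  set_type (subshift rho).

Definition subshift_map (A : topologicalType)
    (rho : continuousType A (nword A)) (x : subshift_type rho) :
    subshift_type rho :=
  exist _ (full_shift (\val x)) (mem_set (shift_subshift (set_mem (valP x)))).

(* Measurable types of the library are pointed, so the Borel sigma-algebra on X
   can only be formed once a point of X is given; the measurable sets do not
   depend on that point. *)
Definition pointed_at (X : topologicalType) (x0 : X) : Type := X.

HB.instance Definition _ (X : topologicalType) (x0 : X) :=
  Topological.on (pointed_at x0).
HB.instance Definition _ (X : topologicalType) (x0 : X) :=
  isPointed.Build (pointed_at x0) x0.

Definition borel_type (X : topologicalType) (x0 : X) :=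
  g_sigma_algebraType (@open (pointed_at x0)).

Section uniquely_ergodic.
Context (R : realType) (X : topologicalType).
Local Open Scope ereal_scope.

Definition regular_measure (x0 : X) (mu : probability (borel_type x0) R) :
    Prop :=
  forall B : set (borel_type x0), measurable B ->
    mu B = ereal_inf [set mu U | U in [set U : set X | open U /\ B `<=` U]] /\
    mu B = ereal_sup [set mu K | K in [set K : set X | compact K /\ K `<=` B]].

Definition invariant_measure (f : X -> X) (x0 : X)
    (mu : probability (borel_type x0) R) : Prop :=
  forall B : set (borel_type x0), measurable B -> mu (f @^-1` B) = mu B.

(* Measures of the library are total functions on sets that are only
   meaningful on measurable sets, hence the form of the uniqueness clause. *)
Definition uniquely_ergodic (f : X -> X) : Prop :=
  exists (x0 : X) (mu : probability (borel_type x0) R),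
    [/\ regular_measure mu, invariant_measure f mu &
        forall nu : probability (borel_type x0) R,
          regular_measure nu -> invariant_measure f nu ->
          forall B : set (borel_type x0), measurable B -> nu B = mu B].

End uniquely_ergodic.

Section operators.
Context (R : realType) (V : normedModType R).

Definition unit_ball : set V := [set x : V | `|x| <= 1].

Definition opnorm (S : V -> V) : R := sup [set `|S x| | x in unit_ball].

Definition compact_operator (C : {linear V -> V}) : Prop :=
  precompact (C @` unit_ball).

Definition quasi_compact (T : {linear V -> V}) : Prop :=
  exists (C : {linear V -> V}) (n : nat),
    [/\ compact_operator C, (1 <= n)%N &
        opnorm (fun x => iter n T x - C x) < 1].

(* The complexification of V is V * V, the pair (x, y) standing for x + iy;
   sub_scalar M l is the complexification of M minus l times the identity. *)
Definition sub_scalar (M : {linear V -> V}) (l : R[i]) (p : V * V) : V * V :=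
  (M p.1 - (complex.Re l *: p.1 - complex.Im l *: p.2),
   M p.2 - (complex.Re l *: p.2 + complex.Im l *: p.1)).

Definition spectrum (M : {linear V -> V}) : set R[i] :=
  [set l | ~ exists S : V * V -> V * V,
     [/\ continuous S, cancel (sub_scalar M l) S & cancel S (sub_scalar M l)]].

Definition spectral_radius (M : {linear V -> V}) : R :=
  sup [set Normc.normc l | l in spectrum M].

End operators.

(* Compactness of A makes the supremum norm finite, so that it is recorded in
   the type. *)
Definition contfun (R : realType) (A : topologicalType)
    (cA : compact [set: A]) : Type := continuousType A R.

Section contfun.
Context (R : realType) (A : topologicalType) (cA : compact [set: A]).
Local Notation E := (contfun R cA).

HB.instance Definition _ := Choice.on E.

Lemma contfun_cts (f : E) : continuous f.
Proof. exact: (@cts_fun A R f). Qed.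

Lemma contfunP (f g : E) : f =1 g -> f = g.
Proof. by move=> fg; apply/(@continuousEP A R). Qed.

Definition mk_contfun (f : A -> R) (cf : continuous f) : E :=
  mkcts cf : continuousType A R.

Lemma contfun0_cts : continuous (fun _ : A => 0 : R).
Proof. by move=> a; exact: cvg_cst. Qed.

Lemma contfunN_cts (f : E) : continuous (fun a => - f a).
Proof. by move=> a; apply: cvgN; exact: (@contfun_cts f a). Qed.

Lemma contfunD_cts (f g : E) : continuous (fun a => f a + g a).
Proof.
by move=> a; apply: cvgD; [exact: (@contfun_cts f a)|exact: (@contfun_cts g a)].
Qed.

Lemma contfunZ_cts (c : R) (f : E) : continuous (fun a => c * f a).
Proof.
by move=> a; apply: cvgM; [exact: cvg_cst|exact: (@contfun_cts f a)].
Qed.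

Definition contfun0 : E := mk_contfun contfun0_cts.
Definition contfunN (f : E) : E := mk_contfun (@contfunN_cts f).
Definition contfunD (f g : E) : E := mk_contfun (@contfunD_cts f g).
Definition contfunZ (c : R) (f : E) : E := mk_contfun (@contfunZ_cts c f).

Let addA : associative contfunD.
Proof. by move=> f g h; apply: contfunP => a /=; exact: addrA. Qed.
Let addC : commutative contfunD.
Proof. by move=> f g; apply: contfunP => a /=; exact: addrC. Qed.
Let add0 : left_id contfun0 contfunD.
Proof. by move=> f; apply: contfunP => a /=; exact: add0r. Qed.
Let addN : left_inverse contfun0 contfunN contfunD.
Proof. by move=> f; apply: contfunP => a /=; exact: addNr. Qed.

HB.instance Definition _ := GRing.isZmodule.Build E addA addC add0 addN.

Let scaleA (c d : R) (f : E) :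
  contfunZ c (contfunZ d f) = contfunZ (c * d) f.
Proof. by apply: contfunP => a /=; exact: mulrA. Qed.
Let scale1 : left_id 1 contfunZ.
Proof. by move=> f; apply: contfunP => a /=; exact: mul1r. Qed.
Let scaleDr : right_distributive contfunZ +%R.
Proof. by move=> c f g; apply: contfunP => a /=; exact: mulrDr. Qed.
Let scaleDl (f : E) : {morph contfunZ^~ f : c d / c + d}.
Proof. by move=> c d; apply: contfunP => a /=; exact: mulrDl. Qed.

HB.instance Definition _ :=
  GRing.Zmodule_isLmodule.Build R E scaleA scale1 scaleDr scaleDl.

Lemma contfunDE (f g : E) (a : A) : (f + g) a = f a + g a.
Proof. by []. Qed.

Lemma contfunZE (c : R) (f : E) (a : A) : (c *: f) a = c * f a.
Proof. by []. Qed.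

Definition supnorm (f : E) : R := sup [set `|f a| | a in [set: A]].

Lemma supnorm_bound (f : E) : has_ubound [set `|f a| | a in [set: A]].
Proof.
have /compact_bounded [M [_ Mf]] : compact (f @` [set: A]).
  apply: continuous_compact => //.
  by apply: continuous_subspaceT; exact: contfun_cts.
exists (M + 1) => _ [a _ <-]; apply: (Mf (M + 1)); last by exists a.
by rewrite ltrDl.
Qed.

Lemma supnorm_ge (f : E) (a : A) : `|f a| <= supnorm f.
Proof. by apply: ub_le_sup; [exact: supnorm_bound|exists a]. Qed.

Lemma supnorm_ge0 (f : E) : 0 <= supnorm f.
Proof.
have [[_ [a _ _]]|S0] := pselect ([set `|f a| | a in [set: A]] !=set0).
  exact: le_trans (supnorm_ge f a).
by rewrite /supnorm (_ : [set _ | _ in _] = set0) ?sup0//; apply/nonemptyPn.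
Qed.

Lemma supnorm_le (f : E) (c : R) :
  0 <= c -> (forall a, `|f a| <= c) -> supnorm f <= c.
Proof.
move=> c0 fc; have [[y Sy]|S0] := pselect ([set `|f a| | a in [set: A]] !=set0).
  by apply: ge_sup; [exists y|move=> _ [a _ <-]].
by rewrite /supnorm (_ : [set _ | _ in _] = set0) ?sup0//; apply/nonemptyPn.
Qed.

Let supnormD (f g : E) : supnorm (f + g) <= supnorm f + supnorm g.
Proof.
apply: supnorm_le => [|a]; first by rewrite addr_ge0 ?supnorm_ge0.
by rewrite contfunDE (le_trans (ler_normD _ _))// lerD ?supnorm_ge.
Qed.

Let supnormZ (c : R) (f : E) : supnorm (c *: f) = `|c| * supnorm f.
Proof.
have le (d : R) (g : E) : supnorm (d *: g) <= `|d| * supnorm g.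
  apply: supnorm_le => [|a]; first by rewrite mulr_ge0 ?supnorm_ge0.
  by rewrite contfunZE normrM ler_wpM2l ?supnorm_ge.
have [->|c0] := eqVneq c 0.
  apply/eqP; rewrite normr0 mul0r eq_le supnorm_ge0 andbT.
  by rewrite (le_trans (le _ _))// normr0 mul0r.
apply/eqP; rewrite eq_le le/=.
rewrite -ler_pdivlMl ?normr_gt0// -normfV.
by rewrite -{1}[f]scale1r -(mulVf c0) -scalerA le.
Qed.

Let supnorm_eq0 (f : E) : supnorm f = 0 -> f = 0.
Proof.
move=> f0; apply: contfunP => a; apply/eqP.
by rewrite -normr_le0 -f0 supnorm_ge.
Qed.

HB.instance Definition _ :=
  Lmodule_isNormed.Build R E supnormD supnormZ supnorm_eq0.

End contfun.

Section substitution_operator.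
Context (R : realType) (A : topologicalType) (cA : compact [set: A]).
Context (rho : continuousType A (nword A)).
Local Notation E := (contfun R cA).

Lemma subst_op_cts (f : E) :
  continuous (fun a => \sum_(b <- subst_letter rho a) f b).
Proof.
pose F n (w : word_of_length A n.+1) := \sum_(b <- letters w) f b.
have cF n : continuous (F n).
  rewrite (_ : F n = fun w => \sum_(i < n.+1) f (w i)); last first.
    by apply/funext => w; rewrite /F /letters big_map big_enum.
  apply: continuous_big => [|i _ w]; first exact: add_continuous.
  apply: (@continuous_comp _ _ _ (fun v : word_of_length A n.+1 => v i) f).
    exact: (@proj_continuous _ (fun=> A) i).
  exact: (@contfun_cts R A cA f (w i)).
move=> a; have := @cts_fun _ _ rho a; move=> crho.
apply: (@continuous_comp _ _ _ rho
  (fun w : nword A => F (projT1 w) (projT2 w))) => //.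
by case: (rho a) => n w U; exact: cF.
Qed.

Definition subst_op_fun (f : E) : E := mk_contfun cA (@subst_op_cts f).

Lemma subst_op_linear : linear subst_op_fun.
Proof.
move=> c f g; apply: contfunP => a /=.
rewrite contfunDE contfunZE /subst_op_fun /=.
by rewrite mulr_sumr -big_split.
Qed.

HB.instance Definition _ :=
  GRing.isLinear.Build R E E *:%R subst_op_fun subst_op_linear.

Definition subst_op : {linear E -> E} := subst_op_fun.

End substitution_operator.

(* Main.v *)
Require Import Defs.
From HB Require Import structures.
From mathcomp Require Import all_boot all_order all_algebra.
From mathcomp Require Import all_classical all_reals all_analysis.
From mathcomp Require Import complex measurable_realfun zify ring lra.

(* A word rho^p(a) contains the isolated letter a0 for every a, with the same p:
   this is primitivity for the open set {a0}. Hence T^p f = L^-p f(a0) + (a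
   positive operator of norm 1 - L^-p), which is quasi-compactness, L being the
   spectral radius of M. The same splitting contracts by 1 - L^-p the oscillation
   of the averages of any bounded function, continuous or not, over the words
   rho^n(a). So the frequency of any set of finite words in rho^n(a) converges
   uniformly in a; points of the subshift being concatenations of blocks rho^n(a),
   an invariant measure has no choice on the sets depending on finitely many
   coordinates, and regularity takes care of the others. An invariant regular
   measure exists on every compact Hausdorff system: the visit frequencies along
   an orbit, taken to the limit along an ultrafilter, form an invariant finitely
   additive mean, from which a Caratheodory construction makes a measure. *)

Set Implicit Arguments.
Unset Strict Implicit.
Unset Printing Implicit Defensive.

Import Order.TTheory GRing.Theory Num.Theory.
Import numFieldNormedType.Exports.

Local Open Scope classical_set_scope.
Local Open Scope ring_scope.

(** * Regular measures on compact Hausdorff spaces *)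

(* compact_cover is stated for pointed spaces only. *)
Lemma finite_subcover (X : topologicalType) (x0 : X) (K : set X)
    (I : choiceType) (D : set I) (f : I -> set X) :
  compact K -> (forall i, D i -> open (f i)) -> K `<=` cover D f ->
  finite_subset_cover D f K.
Proof.
by move=> cK; have := cK : @compact (pointed_at x0) K; rewrite compact_cover; apply.
Qed.

(** * Regular Borel probabilities from finitely additive means *)

Section content_measure.
Context (R : realType) (X : topologicalType) (x0 : X).
Hypotheses (hX : hausdorff_space X) (cX : compact [set: X]).
Variable m : set X -> R.
Hypothesis m_ge0 : forall A, 0 <= m A.
Hypothesis mT : m setT = 1.
Hypothesis m_add : forall A B, A `&` B = set0 -> m (A `|` B) = m A + m B.
Local Open Scope ereal_scope.

Let m_le (A B : set X) : A `<=` B -> (m A <= m B)%R.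
Proof.
move=> AB; rewrite -(setDUK AB) m_add ?lerDl//.
by rewrite setDE setICA setICr setI0.
Qed.

Let m0 : m set0 = 0%R.
Proof.
have := @m_add set0 set0; rewrite setI0 setU0 => /(_ erefl) h.
by apply: (@addrI _ (m set0)); rewrite addr0 -h.
Qed.

(** Only the values of [m] on closed sets enter: [m] need not be countably additive, and compactness
    of closed sets will supply countable subadditivity. *)
Definition open_content (U : set X) : \bar R :=
  ereal_sup [set (m K)%:E | K in [set K | closed K /\ K `<=` U]].

Let lam := open_content.

Let lam_ge (K U : set X) : closed K -> K `<=` U -> (m K)%:E <= lam U.
Proof. by move=> cK KU; apply: ereal_sup_ubound; exists K. Qed.

Let lam_le (U : set X) c : (forall K, closed K -> K `<=` U -> (m K)%:E <= c) ->
  lam U <= c.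
Proof. by move=> h; apply: ge_ereal_sup => _ [K [cK KU] <-]; exact: h. Qed.

Let lam_ge0 U : 0 <= lam U.
Proof.
apply: (@le_trans _ _ (m set0)%:E); first by rewrite m0.
by apply: lam_ge; [exact: closed0|exact: sub0set].
Qed.

Let lam_homo U V : U `<=` V -> lam U <= lam V.
Proof. by move=> UV; apply: lam_le => K cK KU; exact/lam_ge/(subset_trans KU). Qed.

Let lamT : lam setT = 1.
Proof.
apply/eqP; rewrite eq_le; apply/andP; split.
  by apply: lam_le => K _ _; rewrite lee_fin -mT; exact/m_le/subsetT.
by rewrite -[leLHS]/(1%R%:E) -mT; apply: lam_ge => //; exact: closedT.
Qed.

Let lam_le1 U : lam U <= 1.
Proof. by rewrite -lamT; exact/lam_homo/subsetT. Qed.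

Let lam_fin U : lam U \is a fin_num.
Proof. by rewrite ge0_fin_numE// (le_lt_trans (lam_le1 U))// ltry. Qed.

(** For K closed in the union, normality separates the disjoint closed sets K \ U and K \ V by open
    P and Q. Then K \ P is closed and lies in U, while the rest of K, inside P, is contained in K \
    Q, which is closed and lies in V. *)
Let lamU U V : open U -> open V -> lam (U `|` V) <= lam U + lam V.
Proof.
move=> oU oV; apply: lam_le => K cK KUV.
have /(@normal_openP R) nX := compact_normal hX cX.
have clD W : open W -> closed (K `\` W).
  by move=> oW; rewrite setDE; apply: closedI => //; exact: open_closedC.
have KUV0 : (K `\` U) `&` (K `\` V) = set0.
  by apply/seteqP; split => // x [[Kx nU] [_ nV]]; case: (KUV x Kx).
have [P [Q [oP oQ UP VQ PQ0]]] := nX _ _ (clD U oU) (clD V oV) KUV0.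
have KE : K = (K `\` P) `|` (K `&` P) by rewrite setUC setUIDK.
have cP := clD P oP; have cQ := clD Q oQ.
rewrite KE m_add; last by rewrite setIC setDE setIACA setICr setI0.
rewrite EFinD leeD//.
  by apply: lam_ge => // x [Kx nPx]; apply: contrapT => nUx; apply/nPx/UP.
apply: (@le_trans _ _ (m (K `\` Q))%:E).
  rewrite lee_fin m_le// => x [Kx Px]; split => // Qx.
  by have : (P `&` Q) x by []; rewrite PQ0.
by apply: lam_ge => // x [Kx nQx]; apply: contrapT => nVx; apply/nQx/VQ.
Qed.

Let lam_bigsetU (F : nat -> set X) n : (forall i, open (F i)) ->
  lam (\big[setU/set0]_(i < n) F i) <= \sum_(i < n) lam (F i).
Proof.
move=> oF; elim: n => [|n ih].
  by rewrite !big_ord0; apply: lam_le => K _; rewrite subset0 => ->; rewrite m0.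
rewrite !big_ord_recr/=; apply: le_trans (lamU _ (oF n)) _.
  by rewrite -bigcup_mkord; apply: bigcup_open.
exact: leeD.
Qed.

(** A closed K inside the union is compact, so finitely many [F i] already cover it and finite
    subadditivity applies. *)
Let lam_bigcup (F : nat -> set X) : (forall i, open (F i)) ->
  lam (\bigcup_i F i) <= \sum_(i <oo) lam (F i).
Proof.
move=> oF; apply: lam_le => K cK KF.
have [D _ KD] := finite_subcover x0 (subclosed_compact cK cX (@subsetT _ K))
  (fun i _ => oF i) KF.
pose n := (\max_(i <- finmap.enum_fset D) i).+1.
have KDn : K `<=` \big[setU/set0]_(i < n) F i.
  move=> x /KD[i /= iD Fix]; rewrite -bigcup_mkord; exists i => //=.
  by rewrite ltnS; apply: (@leq_bigmax_seq _ _ xpredT (fun i => i) i).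
apply: le_trans (lam_ge cK KDn) _; apply: le_trans (lam_bigsetU n oF) _.
rewrite -(big_mkord xpredT (fun i => lam (F i))).
by apply: nneseries_lim_ge => *; exact: lam_ge0.
Qed.

Definition outer_content (B : set X) : \bar R :=
  ereal_inf [set lam U | U in [set U | open U /\ B `<=` U]].

Let mus := outer_content.

Let mus_le (B U : set X) : open U -> B `<=` U -> mus B <= lam U.
Proof. by move=> oU BU; apply: ereal_inf_lbound; exists U. Qed.

Let mus_ge (B : set X) c : (forall U, open U -> B `<=` U -> c <= lam U) ->
  c <= mus B.
Proof. by move=> h; apply: le_ereal_inf_tmp => _ [U [oU BU] <-]; exact: h. Qed.

Let mus_open U : open U -> mus U = lam U.
Proof.
move=> oU; apply/eqP; rewrite eq_le mus_le//=.
by apply: mus_ge => V oV; exact: lam_homo.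
Qed.

Let mus_ge0 B : 0 <= mus B. Proof. by apply: mus_ge => *; exact: lam_ge0. Qed.

Let mus_homo : {homo mus : A B / A `<=` B >-> A <= B}.
Proof.
by move=> A B AB; apply: mus_ge => U oU BU; exact: mus_le (subset_trans AB BU).
Qed.

Let mus_fin B : mus B \is a fin_num.
Proof.
rewrite ge0_fin_numE//; apply: (@le_lt_trans _ _ 1); last by rewrite ltry.
by rewrite -lamT -mus_open; [exact/mus_homo/subsetT|exact: openT].
Qed.

Let mus0 : mus set0 = 0.
Proof.
apply/eqP; rewrite eq_le mus_ge0 andbT mus_open; last exact: open0.
by apply: lam_le => K _; rewrite subset0 => ->; rewrite m0.
Qed.

Let mus_sigma : sigma_subadditive mus.
Proof.
move=> F; apply/lee_addgt0Pr => e e0.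
apply: le_trans (epsilon_trick xpredT _ (ltW e0)); last by move=> n; exact: mus_ge0.
have h n : exists U, [/\ open U, F n `<=` U &
    lam U <= mus (F n) + (e / (2 ^ n.+1)%:R)%:E].
  have [_ [U [oU FU] <-] lU] : exists2 y,
      [set lam U | U in [set U | open U /\ F n `<=` U]] y & y < mus (F n) + (e / (2 ^ n.+1)%:R)%:E.
    apply/ereal_inf_ltP; rewrite -[ltLHS]/(mus _) lteDl//.
    by rewrite lte_fin divr_gt0// ltr0n expn_gt0.
  by exists U; split => //; exact: ltW.
have [U hU] := choice h.
apply: (@le_trans _ _ (lam (\bigcup_n U n))).
  apply: mus_le; first by apply: bigcup_open => n _; case: (hU n).
  by apply: subset_bigcup => n _; case: (hU n).
apply: le_trans (lam_bigcup _) _; first by move=> n; case: (hU n).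
by apply: lee_nneseries => [n _ _|n _]; [exact: lam_ge0|case: (hU n)].
Qed.

HB.instance Definition _ := isOuterMeasure.Build R (pointed_at x0) mus
  mus0 mus_ge0 mus_homo mus_sigma.

Let nu : {outer_measure set (pointed_at x0) -> \bar R} := mus.

(** For V open around B, take a closed K nearly exhausting the content of V [&] U, then a closed K'
    doing the same for the open set V \ K, which contains B \ U. As K and K' are disjoint, m K + m
    K' is at most the content of V. *)
Let open_cara (U : set X) : open U -> caratheodory_measurable mus U.
Proof.
move=> oU; apply: (@le_caratheodory_measurable R (pointed_at x0) nu) => B.
apply: mus_ge => V oV BV; apply/lee_addgt0Pr => e e0.
have e20 : (0 < e / 2)%R by rewrite divr_gt0.
have adh (W : set X) : exists K, [/\ closed K, K `<=` W &
    lam W - (e / 2)%:E < (m K)%:E].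
  have [_ [K [cK KW] <-] h] := ub_ereal_sup_adherent e20 (lam_fin W).
  by exists K.
have [K [cK KVU hK]] := adh (V `&` U).
have oVK : open (V `\` K) by rewrite setDE; apply: openI => //; exact: closed_openC.
have [K' [cK' K'V hK']] := adh (V `\` K).
have hKK : (m K + m K')%:E <= lam V.
  rewrite -m_add; last first.
    by apply/seteqP; split => // x [Kx /K'V[]].
  apply: lam_ge; first exact: closedU.
  by rewrite subUset; split=> [x /KVU[]//|x /K'V[]//].
have h1 : mus (B `&` U) <= lam (V `&` U).
  by apply: mus_le; [exact: openI|exact: setSI].
have h2 : mus (B `&` ~` U) <= lam (V `\` K).
  apply: mus_le => // x [Bx nUx]; split; first exact: BV.
  by move=> /KVU[].
apply: (@le_trans _ _ (lam (V `&` U) + lam (V `\` K))); first exact: leeD.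
apply: le_trans (leeD2r _ hKK).
move: hK hK'; rewrite -(fineK (lam_fin (V `&` U))) -(fineK (lam_fin (V `\` K))).
rewrite -!EFinB -!EFinD !lte_fin !lee_fin.
set a := fine _; set b := fine _ => ha hb.
by rewrite [e]splitr; have := ltW ha; have := ltW hb; lra.
Qed.

Let T := borel_type x0.

Let borel_cara (B : set T) : measurable B -> caratheodory_measurable mus B.
Proof.
apply: smallest_sub; last exact: open_cara.
by split; [exact: (@measurable0 _ (caratheodory_type nu))
  |move=> A mA; rewrite setTD; exact: (@measurableC _ (caratheodory_type nu))
  |exact: (@bigcupT_measurable _ (caratheodory_type nu))].
Qed.

Let mus_sigma_additive : semi_sigma_additive (mus : set T -> \bar R).
Proof.
move=> F mF tF mUF.
apply: (@caratheodory_measure_sigma_additive R (pointed_at x0) nu) => //.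
- by move=> i; exact: borel_cara.
- exact: borel_cara.
Qed.

Lemma content_measure_exists : exists mu : probability T R,
  regular_measure mu /\
  forall U : set X, open U -> mu U = open_content U.
Proof.
pose mu1 := isMeasure.Build _ _ _ (mus : set T -> \bar R) mus0 mus_ge0 mus_sigma_additive.
pose mu2 : {measure set T -> \bar R} := HB.pack (mus : set T -> \bar R) mu1.
have mu2T : mu2 setT = 1 by rewrite -lamT -mus_open//; exact: openT.
pose mu3 := Measure_isProbability.Build _ _ _ mu2 mu2T.
pose mu : probability T R := HB.pack (mus : set T -> \bar R) mu1 mu3.
exists mu; split => [B mB|]; last exact: mus_open.
split.
  congr ereal_inf; apply/seteqP; split => _ [U [oU BU] <-]; exists U => //.
    exact: mus_open.
  exact/esym/mus_open.
apply/eqP; rewrite eq_le; apply/andP; split; last first.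
  apply: ge_ereal_sup => _ [K [cK KB] <-]; exact: mus_homo.
(* Inner regularity is outer regularity of the complement: if U is open around the complement of B
   and of nearly the same measure, the complement of U is compact, lies in B and misses less than e
   of it. *)
apply/lee_addgt0Pr => e e0.
have [_ [U [oU BU] <-] lU] : exists2 y,
    [set lam U | U in [set U | open U /\ ~` B `<=` U]] y &
      y < mus (~` B) + e%:E.
  by apply/ereal_inf_ltP; rewrite -[ltLHS]/(mus _) lteDl// lte_fin.
have mU : measurable (U : set T) by exact: sub_sigma_algebra.
apply: (@le_trans _ _ (mu (~` U) + e%:E)); last first.
  apply: leeD2r; apply: ereal_sup_ubound; exists (~` U) => //; split.
    by apply: subclosed_compact cX _ => //; exact: open_closedC.
  by rewrite -[B]setCK; exact: subsetC.
have := probability_setC mu mB; have := probability_setC mu mU.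
rewrite -[mu (~` U)]/(mus _) -[mu U]/(mus _) -[mu (~` B)]/(mus _) -[mu B]/(mus _).
move: lU; rewrite -mus_open//.
rewrite -(fineK (mus_fin U)) -(fineK (mus_fin (~` U))).
rewrite -(fineK (mus_fin B)) -(fineK (mus_fin (~` B))).
rewrite -!EFinD lte_fin lee_fin => lU [] h1 [] h2.
by rewrite h1; move: lU; rewrite h2; lra.
Qed.

End content_measure.

Lemma ultra_fmap (T U : Type) (f : T -> U) (F : set_system T) :
  UltraFilter F -> UltraFilter (f @ F).
Proof.
move=> FU; split; first exact: fmap_proper_filter.
move=> H FH sFH; apply/seteqP; split=> // B HB.
have [//|FnB] := in_ultra_setVsetC (f @^-1` B) FU.
have HnB : H (~` B) by exact: sFH.
have : H (B `&` ~` B) by exact: filterI.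
by rewrite setICr => /filter_not_empty.
Qed.

(** * Invariant finitely additive means *)

Section invariant_mean.
Context (R : realType) (X : Type) (f : X -> X) (x : X).

Definition visit_frequency (A : set X) (n : nat) : R :=
  n.+1%:R^-1 * \sum_(i < n.+1) \1_A (iter i f x).

Let visit_frequency_ge0 A n : 0 <= visit_frequency A n.
Proof. by rewrite mulr_ge0// ?sumr_ge0// => i _; rewrite indicE. Qed.

Let visit_frequencyT n : visit_frequency setT n = 1.
Proof.
rewrite /visit_frequency (eq_bigr (fun=> 1)) => [|i _]; last first.
  by rewrite indicT.
by rewrite sumr_const card_ord mulVf// pnatr_eq0.
Qed.

Let visit_frequency_le1 A n : visit_frequency A n <= 1.
Proof.
rewrite -(visit_frequencyT n) ler_wpM2l//; apply: ler_sum => i _.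
by rewrite !indicE in_setT; case: (_ \in _).
Qed.

Let visit_frequencyU A B n : A `&` B = set0 ->
  visit_frequency (A `|` B) n = visit_frequency A n + visit_frequency B n.
Proof.
move=> AB0; rewrite /visit_frequency -mulrDr -big_split/=; congr (_ * _).
apply: eq_bigr => i _; rewrite !indicE in_setU.
have [iA|] := boolP (_ \in A); have [iB|] := boolP (_ \in B); rewrite ?addr0 ?add0r//.
have : (A `&` B) (iter i f x) by split; exact: set_mem.
by rewrite AB0.
Qed.

(** Both sums follow the same orbit, one of them a step ahead, so all but one term of each
    cancel. *)
Let visit_frequency_preimage A n :
  `|visit_frequency (f @^-1` A) n - visit_frequency A n| <= n.+1%:R^-1.
Proof.
rewrite /visit_frequency -mulrBr.
rewrite (_ : \sum_(i < n.+1) \1_(f @^-1` A) (iter i f x) =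
             \sum_(i < n.+1) \1_A (iter i.+1 f x)); last first.
  by apply: eq_bigr => i _; rewrite !indicE.
rewrite big_ord_recr [in X in _ - X]big_ord_recl/=; set s := \sum_(i < n) _.
rewrite (_ : _ - _ = \1_A (f (iter n f x)) - \1_A x); last by lra.
rewrite normrM gtr0_norm// ler_piMr//.
rewrite !indicE; do 2!case: (_ \in _);
  by rewrite ?subrr ?subr0 ?sub0r ?normrN ?normr0 ?normr1.
Qed.

(** Along an ultrafilter finer than the filter at infinity the frequencies of every set converge,
    since they lie in the compact interval [0, 1]. Additivity passes to the limit, and invariance
    holds there because the error is at most 1/(n+1). *)
Lemma invariant_mean_exists : exists m : set X -> R,
  [/\ forall A, 0 <= m A, m setT = 1,
      forall A B, A `&` B = set0 -> m (A `|` B) = m A + m B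
    & forall A, m (f @^-1` A) = m A].
Proof.
have [G [GU ooG]] := ultraFilterLemma (@eventually_filter : ProperFilter \oo).
have h A : exists l : R, visit_frequency A n @[n --> G] --> l.
  have : compact `[0 : R, 1]%classic := @segment_compact R 0 1.
  rewrite compact_ultra => /(_ (visit_frequency A @ G) (ultra_fmap _ GU)).
  case=> [|l [_ lP]]; last by exists l.
  apply: (@filterS _ G _ setT) => [n _|]; last exact: filterT.
  by rewrite /= in_itv/= visit_frequency_ge0 visit_frequency_le1.
have [m mP] := choice h.
exists m; split.
- move=> A; rewrite -(cvg_lim _ (mP A))//; apply: limr_ge.
    by apply/cvg_ex; exists (m A).
  exact: nearW.
- apply: (cvg_unique _ (mP setT)) => //.
  by rewrite (_ : visit_frequency setT = cst 1) ?funeqE//; exact: cvg_cst.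
- move=> A B AB0; apply: (cvg_unique _ (mP (A `|` B))) => //.
  rewrite (_ : visit_frequency _ = visit_frequency A \+ visit_frequency B).
    exact: cvgD.
  by apply/funext => n; exact: visit_frequencyU.
- move=> A; apply: (cvg_unique _ (mP (f @^-1` A))) => //.
  rewrite (_ : visit_frequency _ = fun n => visit_frequency A n +
      (visit_frequency (f @^-1` A) n - visit_frequency A n)); last first.
    by apply/funext => n; rewrite addrC subrK.
  rewrite -[m A]addr0; apply: cvgD => //; apply/norm_cvg0P.
  apply: (@squeeze_cvgr _ _ _ _ (fun=> 0) (fun n => n.+1%:R^-1)).
  + by apply: nearW => n; rewrite normr_ge0 visit_frequency_preimage.
  + exact: cvg_cst.
  + apply: cvg_trans (@cvg_harmonic R); exact: cvg_app.
Qed.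

End invariant_mean.

Lemma borel_preimage (X : topologicalType) (x0 : X) (g : X -> X)
    (B : set (borel_type x0)) : continuous g ->
  measurable B -> measurable (g @^-1` B : set (borel_type x0)).
Proof.
move=> cg mB.
have : measurable_fun setT (g : borel_type x0 -> borel_type x0).
  apply: (@measurability _ _ (borel_type x0) (borel_type x0) setT g
    (@open (pointed_at x0))) => // _ [U oU <-].
  rewrite setTI; apply: sub_sigma_algebra.
  by apply: open_comp => // ? _; exact: cg.
by move=> /(_ measurableT _ mB); rewrite setTI.
Qed.

Theorem krylov_bogoliubov (R : realType) (X : topologicalType) (x0 : X)
    (f : X -> X) : hausdorff_space X -> compact [set: X] -> continuous f ->
  exists mu : probability (borel_type x0) R,
    regular_measure mu /\ invariant_measure f mu.
Proof.
move=> hX cX cf; have [m [m0 mT mD mf]] := invariant_mean_exists R f x0.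
have [mu [rmu openE]] := content_measure_exists x0 hX cX m0 mT mD.
exists mu; split=> //.
have mle (A B : set X) : A `<=` B -> m A <= m B.
  move=> AB; rewrite -(setDUK AB) mD ?lerDl//.
  by rewrite setDE setICA setICr setI0.
(* Closed sets are carried both ways. For K closed in the preimage of U, f(K) is compact, hence
   closed, and K lies in the preimage of f(K), which has the same mean as f(K). For K closed in U,
   its preimage is closed and has the same mean. *)
have muf (U : set X) : open U -> mu (f @^-1` U) = mu U.
  move=> oU; rewrite !openE//; last by apply: open_comp => // ? _; exact: cf.
  apply/eqP; rewrite eq_le; apply/andP; split; apply: ge_ereal_sup.
    move=> _ [K [cK KU] <-]; apply: (@le_trans _ _ (m (f @` K))%:E).
      by rewrite lee_fin -(mf (f @` K)) mle//; exact: preimage_image.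
    apply: ereal_sup_ubound; exists (f @` K) => //; split.
      apply: compact_closed => //; apply: continuous_compact.
        exact: continuous_subspaceT.
      exact: subclosed_compact cX _.
    by move=> _ [y Ky <-]; exact: KU.
  move=> _ [K [cK KU] <-]; rewrite -mf; apply: ereal_sup_ubound.
  exists (f @^-1` K) => //; split; last exact: preimage_subset.
  by apply: closed_comp => // ? _; exact: cf.
have mf_meas (B : set (borel_type x0)) := borel_preimage (B := B) cf.
(* Outer regularity turns the equality on open sets into an inequality on Borel sets; the complement
   of B then gives the reverse inequality. *)
have le (B : set (borel_type x0)) : measurable B -> (mu (f @^-1` B) <= mu B)%E.
  move=> mB; rewrite [leRHS](rmu B mB).1.
  apply: le_ereal_inf_tmp => _ [U [oU BU] <-]; rewrite -(muf U)//.
  have mU : measurable (U : set (borel_type x0)) by exact: sub_sigma_algebra.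
  apply: le_measure; rewrite ?inE//; last exact: preimage_subset.
  - exact: mf_meas.
  - exact: mf_meas.
move=> B mB; apply/eqP; rewrite eq_le le//=.
have := le _ (measurableC mB).
rewrite preimage_setC !probability_setC//; last exact: mf_meas.
have fB := fin_num_measure mu _ mB; have ffB := fin_num_measure mu _ (mf_meas _ mB).
by rewrite -(fineK fB) -(fineK ffB) -!EFinB !lee_fin; lra.
Qed.

(** * Uniqueness from the values on a base of open sets *)

Section regular_measure_basis.
Context (R : realType) (X : topologicalType) (x0 : X) (G : set (set X)).
Hypothesis G_open : G `<=` open.
Hypothesis G0 : G set0.
Hypothesis GU : setU_closed G.
Hypothesis G_basis : forall (U : set X) x, open U -> U x ->
  exists V, [/\ G V, V x & V `<=` U].

Let open_measurable (U : set X) : open U -> measurable (U : set (borel_type x0)).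
Proof. by move=> oU; exact: sub_sigma_algebra. Qed.

(** Finitely many basic sets inside U cover K, and their union stays in G; [G0] is the case of an
    empty cover. *)
Let between (K U : set X) : compact K -> open U -> K `<=` U ->
  exists V, [/\ G V, K `<=` V & V `<=` U].
Proof.
move=> cK oU KU.
have /choice[V hV] x : exists V : set X, U x -> [/\ G V, V x & V `<=` U].
  have [Ux|nUx] := pselect (U x); last by exists set0.
  by have [V ?] := G_basis oU Ux; exists V.
have [||D DU KD] := finite_subcover (I := {classic X}) (D := U) (f := V) x0 cK.
- by move=> x /hV[/G_open].
- by move=> x /KU Ux; exists x => //; case: (hV x Ux).
exists (\big[setU/set0]_(i <- finmap.enum_fset D) V i); split.
- rewrite big_seq; elim/big_ind: _ => // i iD.
  by case: (hV i _) => //; exact/set_mem/DU.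
- by move=> x /KD[i iD Vix]; rewrite -bigcup_seq; exists i.
- rewrite -bigcup_seq => x [i /= iD].
  by case: (hV i _) => [|_ _ /(_ x)//]; exact/set_mem/DU.
Qed.

(** With V in G between a compact K and an open U, mu1 K <= mu1 V = mu2 V <= mu2 U; the supremum
    over K compares the measures on open sets, and outer regularity does the rest. *)
Lemma regular_measure_unique (mu nu : probability (borel_type x0) R) :
  regular_measure mu -> regular_measure nu -> (forall V, G V -> mu V = nu V) ->
  forall B : set (borel_type x0), measurable B -> mu B = nu B.
Proof.
have le (mu1 mu2 : probability (borel_type x0) R) : regular_measure mu1 ->
    (forall V, G V -> mu1 V = mu2 V) ->
    forall U : set X, open U -> (mu1 U <= mu2 U)%E.
  move=> rmu1 mu12 U oU; rewrite (rmu1 U (open_measurable oU)).2.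
  apply: ge_ereal_sup => _ [K [cK KU] <-].
  have [V [GV KV VU]] := between cK oU KU.
  have mV := open_measurable (G_open GV).
  apply: (@le_trans _ _ (mu1 V)).
    (* K is compact but not known to be Borel, so monotonicity is read off the inner regularity of
       V. *)
    rewrite (rmu1 V mV).2; apply: ereal_sup_ubound; by exists K.
  rewrite mu12//; apply: le_measure; rewrite ?inE//; exact: open_measurable.
move=> rmu rnu munu B mB; rewrite (rmu B mB).1 (rnu B mB).1; congr ereal_inf.
have eqU (U : set X) : open U -> mu U = nu U.
  by move=> oU; apply/eqP; rewrite eq_le !le// => V /munu.
by apply/seteqP; split => _ [U [oU BU] <-]; exists U => //; rewrite eqU.
Qed.

End regular_measure_basis.

(** * Words of a substitution of constant length *)

Section occurrences.
Context (A : Type) (m : nat).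
Implicit Types (E : pred (seq A)) (s t : seq A).

(** Number of windows of length m in s that satisfy E. The first test discards the positions near
    the end, where [take m] would return a shorter word. *)
Definition occ E s : nat :=
  \sum_(0 <= i < size s) ((i + m <= size s)%N && E (take m (drop i s))).

Lemma occ_le E s : (occ E s <= size s)%N.
Proof.
rewrite -[leqRHS]muln1 -[X in (_ <= X * 1)%N]subn0 -sum_nat_const_nat.
by apply: leq_sum => i _; exact: leq_b1.
Qed.

(** Each of the first [size s - m] positions starts a full window, which satisfies either E or its
    complement. *)
Lemma occ_predC E s : (size s <= occ E s + occ (predC E) s + m)%N.
Proof.
rewrite addnC -leq_subLR -big_split/=.
have -> : (size s - m = \sum_(0 <= i < size s - m) 1)%N.
  by rewrite sum_nat_const_nat subn0 muln1.
rewrite (big_cat_nat (leq0n (size s - m)%N) (leq_subr _ _))/=.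
apply: leq_trans (leq_addr _ _); rewrite !big_nat; apply: leq_sum => i.
by rewrite leq0n ltn_subRL addnC => /ltnW ->; case: (E _).
Qed.

(** Windows across the junction are counted on the right only. Such lower bounds suffice, since an
    upper bound for E will come from a lower bound for its complement. *)
Lemma occ_cat E s t : (occ E s + occ E t <= occ E (s ++ t))%N.
Proof.
rewrite {3}/occ size_cat (big_cat_nat (leq0n (size s)) (leq_addr _ _))/=.
apply: leq_add; rewrite /occ.
  rewrite !big_nat; apply: leq_sum => i /andP[_ ilt].
  have [ims|//] := boolP (i + m <= size s)%N.
  rewrite (leq_trans ims (leq_addr _ _))/=.
  rewrite drop_cat ilt takel_cat// size_drop.
  by rewrite leq_subRL ?(ltnW ilt).
rewrite -[in leqRHS](add0n (size s)) big_addn !add0n addKn; apply: leq_sum => i _.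
by rewrite drop_cat ltnNge leq_addl/= addnK (addnC _ (size s)) -addnA leq_add2l.
Qed.

Lemma occ_flatten E (ss : seq (seq A)) :
  (\sum_(s <- ss) occ E s <= occ E (flatten ss))%N.
Proof.
elim: ss => [|s ss ih]; first by rewrite big_nil.
by rewrite big_cons /=; apply: leq_trans (occ_cat E _ _); rewrite leq_add2l.
Qed.

End occurrences.

Lemma nth_flatten_const (T : Type) (x0 : T) (q : nat) (ss : seq (seq T)) (i : nat) :
  (0 < q)%N -> all (fun s => size s == q) ss ->
  nth x0 (flatten ss) i = nth x0 (nth [::] ss (i %/ q)) (i %% q).
Proof.
move=> q0; elim: ss i => [|s ss ih] i /=; first by rewrite !nth_nil.
move=> /andP[/eqP ss_q /ih {}ih]; rewrite nth_cat ss_q.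
have [iq|qi] := ltnP; first by rewrite divn_small// modn_small.
by rewrite ih -{3 4}(subnK qi) divnDr// divnn q0 addn1 modnDr.
Qed.

Section substitution_words.
Context (A : topologicalType) (rho : continuousType A (nword A)).
Local Notation W n a := (iter n (subst_word rho) [:: a]).

Lemma subst_word_cat (s t : seq A) :
  subst_word rho (s ++ t) = subst_word rho s ++ subst_word rho t.
Proof. by rewrite /subst_word map_cat flatten_cat. Qed.

Lemma iter_subst_word (n : nat) (s : seq A) :
  iter n (subst_word rho) s = flatten [seq W n b | b <- s].
Proof.
elim: s => [|b s ih] /=; first by elim: n => //= n ->.
rewrite -ih -[b :: s]cat1s; elim: n {ih} => //= n ->.
exact: subst_word_cat.
Qed.

Lemma iter_subst_wordD (n k : nat) (a : A) :
  W (n + k) a = flatten [seq W n b | b <- W k a].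
Proof. by rewrite iterD iter_subst_word. Qed.

Lemma sum_iter_subst_word (n k : nat) (a : A) (F : A -> nat) :
  (\sum_(c <- W (n + k) a) F c = \sum_(b <- W k a) \sum_(c <- W n b) F c)%N.
Proof. by rewrite iter_subst_wordD big_flatten big_map. Qed.

Section constant_length.
Variable L : nat.
Hypothesis size_rho : forall a, size (subst_letter rho a) = L.

Lemma size_iter_subst_word n a : size (W n a) = (L ^ n)%N.
Proof.
elim: n a => //= n ih a.
rewrite -[LHS]/(size (W n.+1 a)) -add1n iter_subst_wordD size_flatten.
rewrite /shape -map_comp sumnE big_map (eq_bigr (fun=> L)) => [|b _]; last first.
  by rewrite /= /subst_word/= cats0.
by rewrite big_const_seq count_predT iter_addn_0 ih expnS.
Qed.

Lemma nth_iter_subst_wordD (a0 : A) (n k i : nat) (a : A) : (0 < L)%N ->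
  (i < L ^ (n + k))%N ->
  nth a0 (W (n + k) a) i =
  nth a0 (W n (nth a0 (W k a) (i %/ L ^ n))) (i %% L ^ n).
Proof.
move=> L0 iL; rewrite iter_subst_wordD (@nth_flatten_const _ _ (L ^ n)).
- by rewrite (nth_map a0)// size_iter_subst_word ltn_divLR ?expn_gt0 ?L0// -expnD addnC.
- by rewrite expn_gt0 L0.
- by apply/allP => _ /mapP[b _ ->]; rewrite size_iter_subst_word.
Qed.

Section return_letter.
Variables (a0 : A) (p : nat).
Hypothesis a0_in : forall a, a0 \in W p a.

(* Doeblin's contraction: the words rho^p(a) all contain a0, hence the sums
   below differ only through their other L^p - 1 letters. *)
Lemma sum_letters_contraction (F : A -> nat) (D j : nat) :
  (forall a, F a <= D)%N -> exists lo, forall a,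
  (lo <= \sum_(c <- W (p * j) a) F c <= lo + (L ^ p - 1) ^ j * D)%N.
Proof.
move=> FD; elim: j => [|j [lo h]].
  by exists 0%N => a; rewrite muln0/= big_seq1 add0n mul1n.
pose S b := (\sum_(c <- W (p * j) b) F c)%N.
exists (S a0 + (L ^ p - 1) * lo)%N => a.
rewrite mulnS (addnC p) sum_iter_subst_word (big_rem _ (a0_in a))/= -/(S a0).
rewrite -addnA !leq_add2l expnS -mulnA -mulnDr.
set e := ((L ^ p - 1) ^ j * D)%N in h *.
have -> : (L ^ p - 1)%N = size (rem a0 (W p a)).
  by rewrite size_rem// size_iter_subst_word subn1.
rewrite ![(size _ * _)%N]mulnC.
rewrite -(iter_addn_0 lo) -(iter_addn_0 (lo + _)%N) -!count_predT -!big_const_seq.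
by apply/andP; split; apply: leq_sum => b _; case/andP: (h b).
Qed.

End return_letter.

End constant_length.
End substitution_words.

(** * Uniform frequencies of windows in iterated images *)

Section uniform_frequencies.
Context (R : realType) (A : topologicalType) (rho : continuousType A (nword A)).
Local Notation W n a := (iter n (subst_word rho) [:: a]).
Variables (L : nat) (a0 : A) (p : nat).
Hypothesis size_rho : forall a, size (subst_letter rho a) = L.
Hypothesis L_gt1 : (1 < L)%N.
Hypothesis a0_in : forall a, a0 \in W p a.

Let expL_gt0 n : (0 < L ^ n)%N. Proof. by rewrite expn_gt0 ltnW. Qed.

(** The word is cut into L^(p j) blocks rho^k(b). Counting inside blocks loses at most m windows per
    block, and the contraction applied to the count of E per block bounds its variation with y by
    (L^p - 1)^j L^k. The upper bound for E so obtained is what makes lo' uniform in y. *)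
Lemma occ_subst_word_bounds (m : nat) (E : pred (seq A)) (k j : nat) :
  exists lo lo', [/\ forall y, (lo <= occ m E (W (k + p * j) y))%N,
    forall y, (lo' <= occ m (predC E) (W (k + p * j) y))%N &
    (L ^ (k + p * j) <= lo + lo' + L ^ (p * j) * m + (L ^ p - 1) ^ j * L ^ k)%N].
Proof.
pose F b := occ m E (W k b).
have [lo h] : exists lo, forall a,
    (lo <= \sum_(c <- W (p * j) a) F c <= lo + (L ^ p - 1) ^ j * L ^ k)%N.
  apply: (sum_letters_contraction size_rho a0_in) => b.
  by apply: leq_trans (occ_le _ _ _) _; rewrite (size_iter_subst_word size_rho).
have occ'_ge y : (L ^ (k + p * j) -
    (lo + L ^ (p * j) * m + (L ^ p - 1) ^ j * L ^ k) <=
    occ m (predC E) (W (k + p * j) y))%N.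
  rewrite iter_subst_wordD; apply: leq_trans (occ_flatten _ _ _).
  rewrite big_map; case/andP: (h y) => _ hy.
  have : (L ^ (k + p * j) <= \sum_(b <- W (p * j) y)
      (occ m E (W k b) + occ m (predC E) (W k b) + m))%N.
    rewrite expnD mulnC -(size_iter_subst_word size_rho (p * j) y).
    rewrite mulnC -iter_addn_0 -count_predT -big_const_seq; apply: leq_sum => b _.
    by rewrite -(size_iter_subst_word size_rho k b) occ_predC.
  rewrite !big_split/= big_const_seq count_predT iter_addn_0.
  rewrite (size_iter_subst_word size_rho) (mulnC m).
  move=> h'; rewrite leq_subLR; apply: leq_trans h' _.
  by rewrite (addnAC lo) (addnAC (lo + _)%N) !leq_add2r.
exists lo, (L ^ (k + p * j) - (lo + L ^ (p * j) * m + (L ^ p - 1) ^ j * L ^ k))%N.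
split=> [y|y|].
- rewrite iter_subst_wordD; apply: leq_trans (occ_flatten _ _ _).
  by rewrite big_map; case/andP: (h y).
- exact: occ'_ge.
- by move: (L ^ (k + _))%N (_ * m)%N ((_ - 1) ^ j * _)%N => u v w; lia.
Qed.

(** Two lower bounds adding up to almost everything pin down the frequency of E up to d, uniformly
    in y. *)
Lemma uniform_frequency (m : nat) (E : pred (seq A)) (d : R) : 0 < d ->
  exists n lo lo', [/\ forall y, (lo <= occ m E (W n y))%N,
    forall y, (lo' <= occ m (predC E) (W n y))%N &
    (1 - d) * (L ^ n)%:R <= lo%:R + lo'%:R].
Proof.
move=> d0; pose q : R := L%:R^-1.
have q0 : 0 < q by rewrite invr_gt0 ltr0n ltnW.
have q1 : q < 1 by rewrite invf_lt1 ?ltr0n ?ltr1n// ltnW.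
have geo (c r : R) : 0 <= r < 1 -> exists k, c * r ^+ k < d / 2.
  move=> /andP[r0 r1].
  have : c * r ^+ k @[k --> \oo] --> c * 0.
    by apply: cvgMr; apply: cvg_expr; rewrite ger0_norm.
  rewrite mulr0 => /cvgr_lt /(_ (d / 2) (divr_gt0 d0 (ltr0n _ 2))).
  by move=> [k _ /(_ k (leqnn k))]; exists k.
(* Relative to the total length L^(k + p j), the junctions cost m L^-k and the variation (1 -
   L^-p)^j; k and j make each of them less than d / 2. *)
have [k hk] : exists k, m%:R * q ^+ k < d / 2 by apply: geo; rewrite ltW.
have qp : 0 < q ^+ p <= 1 by rewrite exprn_gt0//= exprn_ile1// ltW.
have [j hj] : exists j, 1 * (1 - q ^+ p) ^+ j < d / 2.
  by apply: geo; rewrite subr_ge0 ltrBlDr ltrDl; case/andP: qp => -> ->.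
have [lo [lo' [h1 h2 h3]]] := occ_subst_word_bounds m E k j.
exists (k + p * j)%N, lo, lo'; split=> //.
have Lq i : (L ^ i)%:R * q ^+ i = 1 :> R.
  by rewrite natrX -exprMn mulfV ?expr1n// pnatr_eq0 -lt0n ltnW.
have : (L ^ (k + p * j))%:R <= lo%:R + lo'%:R + (L ^ (p * j))%:R * m%:R +
    (L ^ p - 1)%:R ^+ j * (L ^ k)%:R :> R.
  by rewrite -natrX -!natrM -!natrD ler_nat.
have e1 : (L ^ (p * j))%:R * m%:R = (L ^ (k + p * j))%:R * (m%:R * q ^+ k) :> R.
  transitivity ((L ^ k)%:R * q ^+ k * ((L ^ (p * j))%:R * m%:R)).
    by rewrite Lq mul1r.
  by rewrite expnD natrM -!mulrA; congr (_ * _); rewrite mulrCA (mulrC m%:R).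
have e3 : (L ^ p - 1)%:R = (L ^ p)%:R * (1 - q ^+ p) :> R.
  by rewrite mulrBr mulr1 Lq natrB.
have e2 : (L ^ p - 1)%:R ^+ j * (L ^ k)%:R =
    (L ^ (k + p * j))%:R * (1 * (1 - q ^+ p) ^+ j) :> R.
  by rewrite e3 exprMn mul1r expnD natrM expnM [in RHS](natrX _ _ j) mulrC mulrA.
rewrite e1 e2 -lerBlDr -lerBlDr; apply: le_trans.
set N := (L ^ _)%:R; have N0 : 0 <= N by [].
have := ler_wpM2l N0 (ltW hk); have := ler_wpM2l N0 (ltW hj).
by move: (N * (1 * _)) (N * (m%:R * _)) => u v; rewrite mulrBl mul1r; lra.
Qed.

End uniform_frequencies.

(** * The subshift *)

Lemma continuous_prod_topology (T : topologicalType) (I : eqType)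
    (K : I -> topologicalType) (f : T -> prod_topology K) :
  (forall i, continuous (fun t => f t i)) -> continuous f.
Proof.
move=> cf t; apply/cvg_sup => i.
exact: (@continuous_comp_initial _ _ _ (fun g : prod_topology K => g i) f (cf i) t).
Qed.

Section subspace_type.
Context (X : topologicalType) (K : set X).

Lemma set_val_continuous : continuous (set_val : set_type K -> X).
Proof. exact: initial_continuous. Qed.

Lemma set_type_hausdorff : hausdorff_space X -> hausdorff_space (set_type K).
Proof.
move=> hX p q pq; apply/val_inj/hX => B C pB qC.
have [] := pq (set_val @^-1` B) (set_val @^-1` C).
- exact: set_val_continuous.
- exact: set_val_continuous.
- by move=> x [Bx Cx]; exists (set_val x).
Qed.

Lemma set_type_compact : compact K -> compact [set: set_type K].
Proof.
rewrite !compact_ultra => cK F FU _.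
have FK : (set_val @ F) K.
  by apply: (@filterS _ F _ setT) => [x _|]; [exact: set_valP|exact: filterT].
have [p [Kp pF]] := cK _ (ultra_fmap set_val FU) FK.
exists (exist _ p (mem_set Kp)); split=> // B [_ [[W oW <-] Wp WB]].
by apply: filterS WB _; apply: pF; exact: open_nbhs_nbhs.
Qed.

End subspace_type.

Lemma cluster_closed (X : topologicalType) (F : set_system X) (C : set X) (p : X) :
  closed C -> F C -> cluster F p -> C p.
Proof. by move=> cC FC Fp; apply: cC => B pB; exact: Fp. Qed.

Section biinfinite.
Context (A : topologicalType).

Lemma biinfinite_compact : compact [set: A] -> compact [set: biinfinite A].
Proof.
move=> cA; have := @tychonoff int (fun=> A) (fun=> setT) (fun=> cA).
by congr compact; apply/seteqP.
Qed.

Lemma biinfinite_hausdorff : hausdorff_space A -> hausdorff_space (biinfinite A).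
Proof. by move=> hA; exact: (@hausdorff_product int (fun=> A)). Qed.

Lemma biinfinite_proj_continuous (i : int) :
  continuous (fun x : biinfinite A => x i).
Proof. exact: (@proj_continuous int (fun=> A) i). Qed.

Lemma full_shift_continuous : continuous (@full_shift A).
Proof.
by apply: continuous_prod_topology => i; exact: biinfinite_proj_continuous.
Qed.

Lemma subword_continuous (i : int) (n : nat) :
  continuous (fun x : biinfinite A => subword x i n).
Proof.
move=> x; apply: (@continuous_comp _ _ _
  (fun x : biinfinite A => (fun j : 'I_n => x (i + (j : nat)%:Z)) : word_of_length A n)
  (existT (word_of_length A) n)); last exact: existT_continuous.
by apply: continuous_prod_topology => j; exact: biinfinite_proj_continuous.
Qed.

(** Cylinder sets, with no topological condition. An implication suffices, as agreement on the
    window is symmetric in x and y. *)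
Definition finite_window (V : set (biinfinite A)) :=
  exists m : nat, forall x y : biinfinite A,
    (forall i : int, (`|i| <= m)%N -> x i = y i) -> V x -> V y.

Lemma finite_windowI : setI_closed finite_window.
Proof.
move=> V W [m hV] [n hW]; exists (maxn m n) => x y xy [Vx Wx]; split.
  by apply: (hV x) => // i im; apply: xy; rewrite leq_max im.
by apply: (hW x) => // i im; apply: xy; rewrite leq_max im orbT.
Qed.

Lemma finite_windowU : setU_closed finite_window.
Proof.
move=> V W [m hV] [n hW]; exists (maxn m n) => x y xy [Vx|Wx]; [left|right].
  by apply: (hV x) => // i im; apply: xy; rewrite leq_max im.
by apply: (hW x) => // i im; apply: xy; rewrite leq_max im orbT.
Qed.

Lemma finite_window_basis (U : set (biinfinite A)) (x : biinfinite A) :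
  nbhs x U -> exists V, [/\ open V, finite_window V, V x & V `<=` U].
Proof.
(* Unfolding the product topology: C is a basic set around x, a finite intersection of preimages of
   open sets under single projections. *)
move=> [_ [[B sB <-] [C BC Cx] sBU]].
exists C; have [D sD DC] := sB _ BC.
suff [oC wC] : open C /\ finite_window C by split=> // y Cy; apply: sBU; exists C.
rewrite -DC bigcap_fset/= big_seq; elim/big_ind: _ => [|V W [oV wV] [oW wW]|E ED].
- by split; [exact: openT|exists 0%N].
- by split; [exact: openI|exact: finite_windowI].
have /set_mem[i _ [V oV <-]] := sD E ED; split.
  by apply: open_comp => // y _; exact: biinfinite_proj_continuous.
by exists `|i|%N => y z yz /=; rewrite yz.
Qed.

End biinfinite.

Section subshift_topology.
Context (A : topologicalType) (rho : continuousType A (nword A)).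
Hypotheses (cA : compact [set: A]) (hA : hausdorff_space A).
Local Notation W n a := (iter n (subst_word rho) [:: a]).

Lemma subshift_closed : closed (subshift rho).
Proof.
rewrite (_ : subshift rho = \bigcap_(q in [set: int * nat])
    ((fun x => subword x q.1 q.2) @^-1` language rho)).
  apply: closed_bigI => q _; apply: closed_comp; last exact: closed_closure.
  by move=> x _; exact: subword_continuous.
by apply/seteqP; split=> [x Xx q _|x h i n]; [exact: Xx|exact: (h (i, n))].
Qed.

Lemma subshift_type_compact : compact [set: subshift_type rho].
Proof.
apply: set_type_compact.
exact: subclosed_compact subshift_closed (biinfinite_compact cA) (@subsetT _ _).
Qed.

Lemma subshift_type_hausdorff : hausdorff_space (subshift_type rho).
Proof. exact/set_type_hausdorff/biinfinite_hausdorff. Qed.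

Lemma subshift_map_continuous : continuous (@subshift_map A rho).
Proof.
apply: (@continuous_comp_initial (subshift_type rho) _ (biinfinite A) set_val).
move=> x; apply: (@continuous_comp _ _ _ set_val (@full_shift A)).
  exact: set_val_continuous.
exact: full_shift_continuous.
Qed.

(** Compactness gives a cluster point of sequences that carry ever longer generated words around the
    origin; the condition on each window is closed and eventually satisfied. *)
Lemma subshift_nonempty : A -> growing rho -> constant_length rho ->
  exists x, subshift rho x.
Proof.
move=> a [b b2] constL; pose L := size (subst_letter rho a).
have size_rho c : size (subst_letter rho c) = L by exact: constL.
have L2 : (2 <= L)%N by rewrite /L (constL a b).
(* The word rho^(2N)(a) with its letter of index N at the origin. The values that [absz] and the
   default of [nth] produce outside it are irrelevant: once N >= |i| + n, the window of length n at
   i lies inside, as L^(2N) > 2N. *)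
pose u (N : nat) : biinfinite A := fun i => nth a (W (2 * N)%N a) (absz (i + N%:Z)).
have [x [_ xu]] : [set: biinfinite A] `&` cluster (u @ \oo) !=set0.
  by apply: (biinfinite_compact cA); exact: filterT.
exists x => i n.
apply: (cluster_closed (C := (fun y => subword y i n) @^-1` language rho) _ _ xu).
  apply: closed_comp; last exact: closed_closure.
  by move=> y _; exact: subword_continuous.
exists (`|i| + n)%N => //= N /= iN; apply: subset_closure; exists a, (2 * N)%N.
have sizeW : (2 * N < size (W (2 * N) a))%N.
  rewrite (size_iter_subst_word size_rho); exact: ltn_expl.
pose o := (absz (i + N%:Z)).
have -> : letters (projT2 (subword (u N) i n)) = take n (drop o (W (2 * N)%N a)).
  have sz : size (take n (drop o (W (2 * N)%N a))) = n.
    by rewrite size_takel// size_drop /o; lia.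
  apply: (@eq_from_nth _ a); rewrite /letters size_map size_enum_ord ?sz// => k kn.
  rewrite (nth_map (Ordinal kn)) ?size_enum_ord//.
  rewrite /= /u nth_take// nth_drop nth_enum_ord//; congr nth.
  by rewrite /o; lia.
apply/infixP; exists (take o (W (2 * N)%N a)), (drop n (drop o (W (2 * N)%N a))).
by rewrite !cat_take_drop.
Qed.

Lemma subshift_basis (U : set (subshift_type rho)) x : open U -> U x ->
  exists V, [/\ (open V /\ exists2 V', finite_window V' & V = set_val @^-1` V'),
    V x & V `<=` U].
Proof.
move=> [U' oU' <-] Ux.
have [V [oV wV Vx VU]] := finite_window_basis (open_nbhs_nbhs (conj oU' Ux)).
exists (set_val @^-1` V); split=> //; last by move=> y /VU.
split; last by exists V.
by apply: open_comp => // y _; exact: set_val_continuous.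
Qed.

End subshift_topology.

(** Words of length n form an open piece of the disjoint union, so nearby generated words have the
    same length. *)
Lemma language_closure (A : topologicalType) (rho : continuousType A (nword A))
    (n : nat) (w : word_of_length A n) :
  language rho (existT _ n w) ->
  closure [set v : word_of_length A n | generated rho (letters v)] w.
Proof.
move=> lw B wB.
have [u [gu [v Bv vE]]] := lw _ (@existT_nbhs nat (word_of_length A) n w B wB).
by exists v; split=> //; move: gu; rewrite -vE.
Qed.

(** When q divides o the step is a whole q, which is why block offsets below range up to q
    inclusive. *)
Lemma next_multiple (o q : nat) : (0 < q)%N ->
  (o + (q - o %% q) = (o %/ q).+1 * q)%N.
Proof.
move=> q0; rewrite mulSn; have := ltn_pmod o q0; have := divn_eq o q.
by move: (o %/ q * q)%N (o %% q)%N => u v; lia.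
Qed.

(** * Cutting points of the subshift into blocks *)

Section blocks.
Context (A : topologicalType) (rho : continuousType A (nword A)).
Hypotheses (cA : compact [set: A]) (hA : hausdorff_space A).
Local Notation W n a := (iter n (subst_word rho) [:: a]).
Variables (L : nat) (a0 : A).
Hypothesis size_rho : forall a, size (subst_letter rho a) = L.
Hypothesis L_gt1 : (1 < L)%N.

Let expL_gt0 n : (0 < L ^ n)%N. Proof. by rewrite expn_gt0 ltnW. Qed.

(** On each component of the space of words, reading the letter of index i is a projection or the
    constant default. *)
Lemma nth_subst_letter_continuous (i : nat) :
  continuous (fun a => nth a0 (subst_letter rho a) i).
Proof.
pose F n (w : word_of_length A n.+1) := nth a0 (letters w) i.
have cF n : continuous (F n).
  have [iltn|nlei] := ltnP i n.+1.
    rewrite (_ : F n = fun w => w (Ordinal iltn)); last first.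
      apply/funext => w; rewrite /F /letters (nth_map (Ordinal iltn)) ?size_enum_ord//.
      by congr (w _); apply: val_inj; rewrite /= nth_enum_ord.
    exact: (@proj_continuous _ (fun=> A)).
  rewrite (_ : F n = cst a0); first exact: cst_continuous.
  by apply/funext => w; rewrite /F nth_default// size_map size_enum_ord.
move=> a; have crho := @cts_fun _ _ rho a.
apply: (@continuous_comp _ _ _ rho
  (fun w : nword A => F (projT1 w) (projT2 w))) => //.
by case: (rho a) => n w U; exact: cF.
Qed.

Lemma nth_iter_subst_word_continuous (n i : nat) : (i < L ^ n)%N ->
  continuous (fun a => nth a0 (W n a) i).
Proof.
elim: n i => [|n ih] i iL.
  by rewrite expn0 ltnS leqn0 in iL; rewrite (eqP iL) => a; exact: cvg_id.
rewrite (_ : (fun a => _) = (fun a => nth a0 (W n a) (i %% L ^ n)) \o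
    (fun a => nth a0 (subst_letter rho a) (i %/ L ^ n))); last first.
  apply/funext => a; rewrite -addn1 (nth_iter_subst_wordD size_rho)//=.
  - by rewrite /subst_word /= cats0.
  - exact: ltnW.
  - by rewrite addn1.
move=> a; apply: continuous_comp; first exact: nth_subst_letter_continuous.
by apply: ih; rewrite ltn_mod.
Qed.

(** J successive images rho^n(y) starting at position k, with nothing asked of the letters y: a
    consequence of being generated that survives limits. *)
Let blockwise n N k J : set (word_of_length A N) :=
  [set v | forall j, (j < J)%N -> exists y, forall i, (i < L ^ n)%N ->
    nth a0 (letters v) (k + j * L ^ n + i) = nth a0 (W n y) i].

(** The images rho^n(y) form a compact set, the continuous image of the alphabet, hence a closed
    one; each block condition is its preimage under restriction to the block. *)
Let blockwise_closed n N k J : (k + J * L ^ n <= N)%N -> closed (@blockwise n N k J).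
Proof.
move=> kJN; pose q := (L ^ n)%N.
rewrite (_ : @blockwise n N k J = \bigcap_(j in [set j | (j < J)%N])
    [set v | exists y, forall i, (i < q)%N ->
      nth a0 (letters v) (k + j * q + i) = nth a0 (W n y) i]); last by [].
apply: closed_bigI => j jJ.
have kjq : (k + j * q + q <= N)%N.
  apply: leq_trans kJN; rewrite -addnA leq_add2l -mulSnr leq_mul2r.
  by rewrite (jJ : (j < J)%N) orbT.
pose block (v : word_of_length A N) : word_of_length A q :=
  fun i => v (widen_ord kjq (rshift (k + j * q) i)).
have letters_block v i (iq : (i < q)%N) :
    nth a0 (letters v) (k + j * q + i) = block v (Ordinal iq).
  have iN : (k + j * q + i < N)%N by rewrite (leq_trans _ kjq)// ltn_add2l.
  rewrite /letters (nth_map (Ordinal iN)) ?size_enum_ord//.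
  by congr (v _); apply: val_inj; rewrite /= nth_enum_ord.
pose img (y : A) : word_of_length A q := fun i => nth a0 (W n y) i.
have -> : [set v | exists y, forall i, (i < q)%N ->
    nth a0 (letters v) (k + j * q + i) = nth a0 (W n y) i] =
    block @^-1` range img.
  apply/seteqP; split=> [v [y vy]|v [y _ vy]].
    exists y => //; apply/funext => i; rewrite /img -vy ?ltn_ord//.
    by rewrite (letters_block _ _ (ltn_ord i)); congr block; exact: val_inj.
  by exists y => i iq; rewrite (letters_block _ _ iq) -vy.
apply: closed_comp => [v _|].
  by apply: continuous_prod_topology => i; exact: (@proj_continuous _ (fun=> A)).
apply: compact_closed; first exact: (@hausdorff_product _ (fun=> A)).
apply: continuous_compact => //; apply: continuous_subspaceT.
apply: continuous_prod_topology => i; exact: nth_iter_subst_word_continuous.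
Qed.

(** By its length, v can only occur in rho^K(a) with n <= K, and rho^K(a) splits into blocks of
    length L^n. Skipping to the next cut uses up at most one of the J + 1 block lengths of v. *)
Let generated_blockwise n J (v : word_of_length A (J.+1 * L ^ n)) :
  generated rho (letters v) ->
  exists2 k, (k <= L ^ n)%N & blockwise n k J v.
Proof.
move=> [a [K /infixP[s [t vE]]]]; pose q := (L ^ n)%N; pose o := size s.
have q0 : (0 < q)%N := expL_gt0 n.
have sizev : size (letters v) = (J.+1 * q)%N by rewrite size_map size_enum_ord.
have sizeK : (L ^ K = o + (J.+1 * q + size t))%N.
  by rewrite -(size_iter_subst_word size_rho K a) vE !size_cat sizev.
have nK : (n <= K)%N.
  rewrite -(leq_exp2l _ _ L_gt1) sizeK -/q.
  by apply: leq_trans (leq_addl _ _); rewrite mulSn -addnA leq_addr.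
have oE : (o + (q - o %% q) = (o %/ q).+1 * q)%N.
  exact: next_multiple.
exists (q - o %% q)%N => [|j jJ]; first exact: leq_subr.
exists (nth a0 (W (K - n) a) ((o %/ q).+1 + j)) => i iq.
have kN : (q - o %% q + j * q + i < J.+1 * q)%N.
  apply: (@leq_trans (q + j * q + q)).
    by rewrite -addnS leq_add// leq_add2r leq_subr.
  by rewrite -addnA -mulSnr -mulSn leq_mul2r ltnS jJ orbT.
have posE : (((o %/ q).+1 + j) * q + i = o + (q - o %% q + j * q + i))%N.
  by rewrite mulnDl -oE !addnA.
have -> : nth a0 (letters v) (q - o %% q + j * q + i) =
    nth a0 (W K a) (((o %/ q).+1 + j) * q + i).
  by rewrite posE vE nth_cat ltnNge leq_addr/= addKn nth_cat sizev kN.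
rewrite -{1}(subnKC nK) (nth_iter_subst_wordD size_rho) ?subnKC//.
- by rewrite divnMDl// (divn_small iq) addn0 modnMDl modn_small.
- exact: ltnW.
- by rewrite sizeK posE ltn_add2l (leq_trans kN)// leq_addr.
Qed.

(** The offset k takes finitely many values, so the union of the closed sets [blockwise] over k is
    closed and contains the limits of generated words. *)
Lemma subshift_blocks (n J : nat) (x : biinfinite A) : subshift rho x ->
  exists2 k, (k <= L ^ n)%N & forall j, (j < J)%N ->
  exists y, forall i, (i < L ^ n)%N ->
    x (k + j * L ^ n + i)%N%:Z = nth a0 (W n y) i.
Proof.
move=> Xx; pose N := (J.+1 * L ^ n)%N.
pose w : word_of_length A N := projT2 (subword x 0 N).
pose C := \bigcup_(k in `I_(L ^ n).+1) @blockwise n N k J.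
have closedC : closed C.
  apply: closed_bigcup => [|k /= kq]; first exact: finite_II.
  by apply: blockwise_closed; rewrite /N mulSn leq_add2r.
have : C w.
  apply: closedC; apply: closureS (language_closure (Xx 0 N)) => v gv.
  by have [k kq vk] := generated_blockwise gv; exists k.
move=> [k /= kq wk]; exists k => // j jJ; have [y wy] := wk j jJ.
exists y => i iq; rewrite -wy//.
have iN : (k + j * L ^ n + i < N)%N.
  apply: (@leq_trans (L ^ n + j * L ^ n + L ^ n)).
    by rewrite -addnS leq_add// leq_add2r.
  by rewrite -addnA -mulSnr -mulSn leq_mul2r ltnS jJ orbT.
by rewrite /letters (nth_map (Ordinal iN)) ?size_enum_ord// /w /= nth_enum_ord//.
Qed.

End blocks.

(** * Invariant measures of the subshift *)

Section invariant_measure_visits.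
Context (R : realType) (X : topologicalType) (x0 : X) (f : X -> X).
Hypothesis cf : continuous f.
Variable mu : probability (borel_type x0) R.
Hypothesis mu_f : invariant_measure f mu.
Local Notation T := (borel_type x0).

Lemma iter_preimage_measurable (n : nat) (B : set T) :
  measurable B -> measurable (iter n f @^-1` B : set T).
Proof.
move=> mB; elim: n => [//|n ih].
have -> : iter n.+1 f @^-1` B = f @^-1` (iter n f @^-1` B).
  by apply/seteqP; split=> x /=; rewrite -iterS iterSr.
exact: borel_preimage.
Qed.

Lemma invariant_measure_iter (n : nat) (B : set T) :
  measurable B -> mu (iter n f @^-1` B) = mu B.
Proof.
move=> mB; elim: n => [//|n ih].
have -> : iter n.+1 f @^-1` B = f @^-1` (iter n f @^-1` B).
  by apply/seteqP; split=> x /=; rewrite -iterS iterSr.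
by rewrite mu_f//; exact: iter_preimage_measurable.
Qed.

(** Integrate the pointwise inequality: by invariance each indicator has integral mu B. *)
Lemma invariant_measure_ge_visits (N : nat) (c : R) (B : set T) : 0 <= c ->
  measurable B -> (forall x, c <= \sum_(i < N) \1_B (iter i f x)) ->
  c <= N%:R * fine (mu B).
Proof.
move=> c0 mB hc; rewrite -lee_fin EFinM fineK ?fin_num_measure//.
have -> : (N%:R%:E * mu B = \sum_(i < N) mu (iter i f @^-1` B))%E.
  rewrite (eq_bigr (fun=> mu B)) => [|i _]; last exact: invariant_measure_iter.
  rewrite -(fineK (fin_num_measure mu _ mB)) sumEFin sumr_const card_ord -EFinM.
  by rewrite mulr_natl.
have -> : (\sum_(i < N) mu (iter i f @^-1` B) =
    \int[mu]_x (\sum_(i < N) (\1_(iter i f @^-1` B) x)%:E))%E.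
  rewrite ge0_integral_sum//=.
  - apply: eq_bigr => i _; rewrite integral_indic// ?setIT//.
    exact: iter_preimage_measurable.
  - move=> i; apply/measurable_EFinP; apply: measurable_indic.
    exact: iter_preimage_measurable.
have -> : (c%:E = \int[mu]_x (cst c%:E x))%E.
  by rewrite integral_cst// [X in (_ * X)%E](@probability_setT _ _ _ mu) mule1.
apply: ge0_le_integral => //.
- apply: emeasurable_sum => i; apply/measurable_EFinP; apply: measurable_indic.
  exact: iter_preimage_measurable.
- by move=> x _; rewrite sumEFin lee_fin; exact: hc.
Qed.

End invariant_measure_visits.

Section window_sums.
Context (A : topologicalType) (rho : continuousType A (nword A)).
Hypotheses (cA : compact [set: A]) (hA : hausdorff_space A).
Local Notation W n a := (iter n (subst_word rho) [:: a]).
Variables (L : nat) (a0 : A).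
Hypothesis size_rho : forall a, size (subst_letter rho a) = L.
Hypothesis L_gt1 : (1 < L)%N.

Definition window (m : nat) (x : biinfinite A) (i : nat) : seq A :=
  mkseq (fun t => x (i + t)%N%:Z) m.

Lemma iter_full_shift (n : nat) (x : biinfinite A) (i : int) :
  iter n (@full_shift A) x i = x (i + n%:Z).
Proof.
elim: n x i => [|n ih] x i /=; first by rewrite addr0.
by rewrite /full_shift ih -addrA -intS.
Qed.

Lemma window_iter (m n i : nat) (x : biinfinite A) :
  window m (iter n (@full_shift A) x) i = window m x (n + i).
Proof.
apply: eq_map => t; rewrite iter_full_shift; congr x.
by rewrite -PoszD; congr Posz; rewrite addnC addnA.
Qed.

(** Among (J + 1) L^n positions there are J complete blocks rho^n(y), each contributing at least lo
    through the windows it contains. *)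
Lemma window_sum_ge (m : nat) (E : pred (seq A)) (n lo J : nat)
    (x : biinfinite A) : subshift rho x ->
  (forall y, (lo <= occ m E (W n y))%N) ->
  (J * lo <= \sum_(i < J.+1 * L ^ n) E (window m x i))%N.
Proof.
move=> Xx hlo; have [k kq hx] := subshift_blocks cA hA a0 size_rho L_gt1 n J Xx.
set q := (L ^ n)%N in kq hx *.
pose G i : nat := E (window m x i).
have block_ge j : (j < J)%N -> (lo <= \sum_(0 <= i < q) G (k + j * q + i))%N.
  move=> /hx[y hy]; apply: leq_trans (hlo y) _; rewrite /occ.
  rewrite (size_iter_subst_word size_rho) -/q !big_nat.
  apply: leq_sum => i /andP[_ iq]; have [imq|//] := boolP (i + m <= q)%N.
  suff -> : take m (drop i (W n y)) = window m x (k + j * q + i) by [].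
  have szt : size (take m (drop i (W n y))) = m.
    rewrite size_takel// size_drop (size_iter_subst_word size_rho) -/q.
    by rewrite leq_subRL ?(ltnW iq).
  apply: (@eq_from_nth _ a0); rewrite szt ?size_mkseq// => t tm.
  rewrite nth_take// nth_drop nth_mkseq// -addnA hy//.
  by apply: leq_trans imq; rewrite ltn_add2l.
have kJ : (k + J * q <= J.+1 * q)%N by rewrite mulSn leq_add2r.
have kN : (k <= J.+1 * q)%N by apply: leq_trans kJ; rewrite leq_addr.
apply: (@leq_trans (\sum_(k <= i < k + J * q) G i)%N); last first.
  rewrite -(big_mkord xpredT G) (big_cat_nat (leq0n k) kN).
  rewrite [X in (_ <= _ + X)%N](big_cat_nat (leq_addr _ k) kJ)/=.
  by apply: leq_trans (leq_addl _ _); exact: leq_addr.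
elim: J {Xx hx kJ kN} block_ge => [//|J ih] block_ge.
rewrite mulSn addnC (big_cat_nat (n := k + J * q))/= ?leq_addr//; last first.
  by rewrite leq_add2l leq_mul2r leqnSn orbT.
apply: leq_add; first by apply: ih => j jJ; apply: block_ge; exact: ltnW.
rewrite -[X in index_iota X _]add0n big_addn mulSn addnCA addnK.
by apply: leq_trans (block_ge J (ltnSn J)) _; apply: leq_sum => i _; rewrite addnC.
Qed.

End window_sums.

Section unique_invariant_measure.
Context (R : realType) (A : topologicalType) (rho : continuousType A (nword A)).
Hypotheses (cA : compact [set: A]) (hA : hausdorff_space A).
Local Notation W n a := (iter n (subst_word rho) [:: a]).
Variables (L : nat) (a0 : A) (p : nat).
Hypothesis size_rho : forall a, size (subst_letter rho a) = L.
Hypothesis L_gt1 : (1 < L)%N.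
Hypothesis a0_in : forall a, a0 \in W p a.
Variable x0 : subshift_type rho.
Local Notation X := (subshift_type rho).
Local Notation T := (borel_type x0).
Local Notation f := (@subshift_map A rho).

Let val_iter (i : nat) (x : X) : \val (iter i f x) = iter i (@full_shift A) (\val x).
Proof. by elim: i => //= i <-. Qed.

Let window_probability_ge (mu : probability T R) (m : nat) (E : pred (seq A))
    (C : set T) (n lo : nat) : invariant_measure f mu -> measurable C ->
  (forall x : X, C x <-> E (window m (\val x) 0)) ->
  (forall y, (lo <= occ m E (W n y))%N) ->
  lo%:R <= (L ^ n)%:R * fine (mu C).
Proof.
move=> mu_f mC CE hlo; set v := fine _; set Q : R := (L ^ n)%:R.
have h (J : nat) : J%:R * lo%:R <= J.+1%:R * (Q * v).
  rewrite mulrA -!natrM.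
  apply: (invariant_measure_ge_visits (@subshift_map_continuous A rho) mu_f) => // x.
  rewrite [leRHS](eq_bigr (fun i : 'I_ _ => (E (window m (\val x) i))%:R)); last first.
    move=> i _; rewrite indicE; congr (nat_of_bool _)%:R.
    apply/idP/idP => [/set_mem/CE|Ex]; first by rewrite val_iter window_iter addn0.
    by apply/mem_set/CE; rewrite val_iter window_iter addn0.
  rewrite -natr_sum ler_nat.
  exact: (window_sum_ge cA hA a0 size_rho L_gt1 J (set_valP x) hlo).
have Qv0 : 0 <= Q * v by rewrite mulr_ge0// fine_ge0.
(* The ratio J / (J + 1) tends to 1: otherwise any J above Q v / (lo - Q v) contradicts [h]. *)
rewrite leNgt; apply/negP => Qvlo.
have d0 : 0 < lo%:R - Q * v by rewrite subr_gt0.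
have := archi_boundP (divr_ge0 Qv0 (ltW d0)); set J := Num.bound _.
rewrite ltr_pdivrMr// => hJ; have := h J; rewrite -natr1; move: hJ.
by move: (J%:R) (Q * v) => j w; nra.
Qed.

(** The bound lo is used for one measure on C, lo' for the other on the complement of C. Since lo +
    lo' is almost L^n, the two values differ by at most d in either direction. *)
Lemma window_probability_unique (mu nu : probability T R) (m : nat)
    (E : pred (seq A)) (C : set T) :
  invariant_measure f mu -> invariant_measure f nu -> measurable C ->
  (forall x : X, C x <-> E (window m (\val x) 0)) -> mu C = nu C.
Proof.
move=> mu_f nu_f mC CE.
have CE' (x : X) : (~` C) x <-> predC E (window m (\val x) 0).
  by split=> [nC|/negP nE]; [apply/negP => /CE|move=> /CE].
suff le (mu1 mu2 : probability T R) : invariant_measure f mu1 ->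
    invariant_measure f mu2 -> (mu2 C <= mu1 C)%E.
  by apply/eqP; rewrite eq_le !le.
move=> f1 f2; rewrite -(fineK (fin_num_measure mu1 _ mC)).
rewrite -(fineK (fin_num_measure mu2 _ mC)) lee_fin.
apply/ler_addgt0Pr => d d0.
have [n [lo [lo' [h1 h2 h3]]]] := uniform_frequency size_rho L_gt1 a0_in m E d0.
have k1 := window_probability_ge f1 mC CE h1.
have k2 := window_probability_ge f2 (measurableC mC) CE' h2.
have Q0 : 0 < (L ^ n)%:R :> R by rewrite ltr0n expn_gt0 ltnW.
rewrite -(ler_pM2l Q0) mulrDr; move: k2.
rewrite probability_setC// fineB ?fin_num_measure//=.
by move: k1 h3; move: (fine _) (fine _) _%:R => u v w; nra.
Qed.

Theorem invariant_measure_unique (mu nu : probability T R) :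
  regular_measure mu -> invariant_measure f mu ->
  regular_measure nu -> invariant_measure f nu ->
  forall B : set T, measurable B -> mu B = nu B.
Proof.
move=> rmu mu_f rnu nu_f.
pose G : set (set X) :=
  [set V | open V /\ exists2 V', finite_window V' & V = set_val @^-1` V'].
apply: (@regular_measure_unique R X x0 G) => //.
- by move=> V [].
- split; first exact: open0.
  by exists set0; [exists 0%N|rewrite preimage_set0].
- move=> V1 V2 [oV [V' wV VE]] [oW [W' wW WE]]; split; first exact: openU.
  by exists (V' `|` W'); [exact: finite_windowU|rewrite preimage_setU VE WE].
- by move=> U x oU Ux; have [V [GV Vx VU]] := subshift_basis oU Ux; exists V.
move=> V [oV [V' [m wV] VE]].
have mV : measurable (V : set T) by exact: sub_sigma_algebra.
(* Invariance moves the window of V from [-m, m] to [0, 2m]. *)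
rewrite -(invariant_measure_iter (@subshift_map_continuous A rho) mu_f m mV).
rewrite -(invariant_measure_iter (@subshift_map_continuous A rho) nu_f m mV).
(* E recentres a word of length 2m + 1 at its middle letter; the values put outside [-m, m] do not
   affect membership in V'. *)
pose E (s : seq A) := `[< V' (fun i : int => nth a0 s (absz (i + m%:Z))) >].
apply: (@window_probability_unique mu nu (2 * m).+1 E) => //.
  exact: (iter_preimage_measurable (@subshift_map_continuous A rho)).
move=> x; rewrite VE /preimage/=.
have agree (i : int) : (`|i| <= m)%N ->
    \val (iter m f x) i = nth a0 (window (2 * m).+1 (\val x) 0) (absz (i + m%:Z)).
  move=> im; rewrite nth_mkseq; last by lia.
  by rewrite val_iter iter_full_shift; congr (\val x _); lia.
split=> [Vx|/asboolP Ex]; first by apply/asboolP; apply: wV Vx.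
by apply: wV Ex => i im; exact/esym/agree.
Qed.

End unique_invariant_measure.

Theorem subshift_uniquely_ergodic (R : realType) (A : topologicalType)
    (rho : continuousType A (nword A)) (a0 : A) (p : nat) :
  compact [set: A] -> hausdorff_space A -> growing rho -> constant_length rho ->
  (forall a, a0 \in iter p (subst_word rho) [:: a]) ->
  uniquely_ergodic R (@subshift_map A rho).
Proof.
move=> cA hA grow constL a0_in.
have [x Xx] := subshift_nonempty cA a0 grow constL.
pose x0 : subshift_type rho := exist _ x (mem_set Xx).
have size_rho a : size (subst_letter rho a) = size (subst_letter rho a0).
  exact: constL.
have L_gt1 : (1 < size (subst_letter rho a0))%N.
  by have [b b2] := grow; rewrite (constL a0 b).
have [mu [rmu mu_f]] := @krylov_bogoliubov R _ x0 _
  (subshift_type_hausdorff (rho := rho) hA) (subshift_type_compact cA)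
  (@subshift_map_continuous A rho).
exists x0, mu; split=> // nu rnu nu_f B mB.
exact: (invariant_measure_unique cA hA size_rho L_gt1 a0_in rnu nu_f rmu mu_f mB).
Qed.

(** * The substitution operator *)

Section contfun_complete.
Context (R : realType) (A : topologicalType) (cA : compact [set: A]).
Local Notation E := (contfun R cA).

Let contfun_norm_lt (f g : E) (e : R) : `|f - g| < e -> forall a, `|f a - g a| < e.
Proof. by move=> fg a; apply: le_lt_trans fg; exact: (supnorm_ge (f - g)). Qed.

(** Serves the convergence of the Neumann series. Letting g run along F in |f a - g a| < e shows
    that some f is uniformly within e of the pointwise limit, which is therefore continuous. *)
Let contfun_cauchy_cvg (F : set_system E) : ProperFilter F -> cauchy F -> cvg F.
Proof.
move=> FF /cauchyP Fc.
have Fa e : 0 < e -> exists f : E, F [set g | `|f - g| < e].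
  by move=> e0; have [f] := Fc e e0; rewrite -ball_normE; exists f.
have /choice[l hl] a : exists l : R, (fun f : E => f a) @ F --> l.
  apply/cvg_ex; apply: cauchy_cvg; apply/cauchyP => e e0; have [f Ff] := Fa e e0.
  exists (f a).
  suff : F [set g : E | ball (f a) e (g a)] by [].
  by apply: filterS Ff => g /contfun_norm_lt/(_ a); rewrite /= -ball_normE.
have near_l e : 0 < e -> exists f : E,
    F [set g | `|f - g| < e] /\ forall a, `|f a - l a| <= e.
  move=> e0; have [f Ff] := Fa e e0; exists f; split=> // a.
  have fl : `|f a - (g : E) a| @[g --> F] --> `|f a - l a|.
    by apply: cvg_norm; apply: cvgB => //; exact: cvg_cst.
  rewrite -(cvg_lim _ fl)//; apply: limr_le; first by apply/cvg_ex; eexists; exact: fl.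
  by apply: filterS Ff => g /contfun_norm_lt/(_ a)/ltW.
have cl : continuous l.
  move=> a; apply/cvgrPdist_lt => e e0.
  have e40 : 0 < e / 4 by rewrite divr_gt0.
  have [f [_ fl]] := near_l _ e40.
  have /cvgrPdist_lt/(_ _ e40) := @contfun_cts R A cA f a.
  apply: filterS => b fab; have := fl a; have := fl b; move: fab.
  rewrite !ltr_norml !ler_norml => /andP[? ?] /andP[? ?] /andP[? ?].
  by apply/andP; split; lra.
apply/cvg_ex; exists (mk_contfun cA cl); apply/cvgrPdist_lt => e e0.
have e40 : 0 < e / 4 by rewrite divr_gt0.
have [f [Ff fl]] := near_l _ e40.
apply: filterS Ff => g fg; apply: (@le_lt_trans _ _ (e / 2)); last by lra.
apply: supnorm_le => [|a]; first by rewrite divr_ge0// ltW.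
have := contfun_norm_lt fg a; have := fl a; rewrite contfunDE/=.
rewrite ltr_norml !ler_norml => /andP[? ?] /andP[? ?].
by rewrite -[mkcts cl a]/(l a) -[mkcts _ a]/(- (g a)); apply/andP; split; lra.
Qed.

HB.instance Definition _ := Uniform_isComplete.Build E contfun_cauchy_cvg.

End contfun_complete.

(* The cancellations that make the Neumann series a two-sided inverse. *)
Lemma resolvent_identities (V : zmodType) (A B C D x : V) :
  [/\ A - B - x - (A - C) - (D + C - (D + B)) = - x,
     A - B - x - (A + C) + (D + C - (D - B)) = - x,
     A - B - x - (D + C) - (A - D - (C + B)) = - x &
     A - B - x + (D + C) - (A + D + (C - B)) = - x].
Proof.
(* Both sides become integer combinations of the five elements, and the identities reduce to
   computing coefficients. *)
pose F (a b c d e : int) := A *~ a + B *~ b + C *~ c + D *~ d + x *~ e.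
have FD a b c d e a' b' c' d' e' : F a b c d e + F a' b' c' d' e' =
    F (a + a') (b + b') (c + c') (d + d') (e + e').
  by rewrite /F !mulrzDr; do 4!(rewrite addrACA; congr (_ + _)).
have FN a b c d e : - F a b c d e = F (- a) (- b) (- c) (- d) (- e).
  by rewrite /F !mulrNz !opprD.
have AE : A = F 1 0 0 0 0 by rewrite /F !mulr0z !addr0.
have BE : B = F 0 1 0 0 0 by rewrite /F !mulr0z !addr0 add0r.
have CE : C = F 0 0 1 0 0 by rewrite /F !mulr0z !addr0 !add0r.
have DE : D = F 0 0 0 1 0 by rewrite /F !mulr0z !addr0 !add0r.
have xE : x = F 0 0 0 0 1 by rewrite /F !mulr0z !add0r.
by rewrite {}AE {}BE {}CE {}DE {}xE; do ?split; rewrite !(FN, FD).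
Qed.

(** * Neumann series and the bound on the spectrum *)

Section operator_series.
Context (R : realType) (V : completeNormedModType R) (M : {linear V -> V}).
Variable L : R.
Hypothesis L0 : 0 <= L.
Hypothesis M_le : forall x, `|M x| <= L * `|x|.

Lemma iter_op_le n x : `|iter n M x| <= L ^+ n * `|x|.
Proof.
elim: n => [|n ih] /=; first by rewrite expr0 mul1r.
by apply: le_trans (M_le _) _; rewrite exprS -mulrA ler_wpM2l.
Qed.

Lemma iter_opP n a x y : iter n M (a *: x + y) = a *: iter n M x + iter n M y.
Proof. by elim: n => //= n ->; rewrite linearP. Qed.

Lemma op_continuous : continuous M.
Proof.
apply: bounded_linear_continuous; apply/ex_bound; exists L.
have := @nbhs0_lt _ V 1 ltr01; apply: filterS => x /ltW x1.
by apply: le_trans (M_le x) _; rewrite -[leRHS]mulr1 ler_wpM2l.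
Qed.

Definition op_series (e : nat -> R) (x : V) : V :=
  limn (series (fun n => e n *: iter n M x)).

Section summable_coefficients.
Variables (e : nat -> R) (C q : R).
Hypotheses (q0 : 0 <= q) (q1 : q < 1).
Hypothesis e_le : forall n, `|e n| * L ^+ n <= C * q ^+ n.

Let term_le n x : `|e n *: iter n M x| <= C * `|x| * q ^+ n.
Proof.
rewrite normrZ; apply: (@le_trans _ _ (`|e n| * L ^+ n * `|x|)).
  by rewrite -mulrA ler_wpM2l// iter_op_le.
by rewrite [leRHS]mulrAC ler_wpM2r.
Qed.

Let cvg_geo (x : V) : series (geometric (C * `|x|) q) @ \oo --> (C * `|x|) * (1 - q)^-1.
Proof. by apply: cvg_geometric_series; rewrite ger0_norm. Qed.

Let cvg_norm_terms x : cvgn [normed series (fun n => e n *: iter n M x)].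
Proof.
apply: (@series_le_cvg _ _ (geometric (C * `|x|) q)) => //.
- by move=> n; rewrite /= normr_ge0.
- by move=> n; apply: le_trans (term_le n x); rewrite normr_ge0.
- by move=> n; exact: term_le.
- by apply/cvg_ex; eexists; exact: cvg_geo.
Qed.

Lemma op_series_cvg x :
  series (fun n => e n *: iter n M x) @ \oo --> op_series e x.
Proof. by rewrite /op_series; apply: normed_cvg; exact: cvg_norm_terms. Qed.

Lemma op_series_le x : `|op_series e x| <= C / (1 - q) * `|x|.
Proof.
rewrite /op_series; apply: le_trans.
  by apply: lim_series_norm; exact: cvg_norm_terms.
rewrite mulrAC -(cvg_lim _ (@cvg_geo x))//.
apply: lim_series_le => [||n]; [exact: cvg_norm_terms| |exact: term_le].
by apply/cvg_ex; eexists; exact: cvg_geo.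
Qed.

Lemma op_seriesP a x y :
  op_series e (a *: x + y) = a *: op_series e x + op_series e y.
Proof.
apply: (cvg_unique _ (@op_series_cvg (a *: x + y))) => //.
rewrite (_ : series _ = (fun n => a *: series (fun n => e n *: iter n M x) n +
    series (fun n => e n *: iter n M y) n)); last first.
  apply/funext => n; rewrite /series/= scaler_sumr -big_split/=.
  by apply: eq_bigr => i _; rewrite iter_opP scalerDr !scalerA mulrC.
by apply: cvgD; [apply: cvgZr|]; exact: op_series_cvg.
Qed.

Lemma op_series_comm x : M (op_series e x) = op_series e (M x).
Proof.
apply: (cvg_unique _ _ (@op_series_cvg (M x))) => //.
rewrite (_ : series _ = M \o series (fun n => e n *: iter n M x)); last first.
  apply/funext => n; rewrite /series/= linear_sum/=; apply: eq_bigr => i _.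
  by rewrite linearZ/= -iterS iterSr.
by apply: continuous_cvg; [exact: op_continuous|exact: op_series_cvg].
Qed.

Lemma op_series_continuous : continuous (op_series e).
Proof.
have C0 : 0 <= C.
  by have := e_le 0; rewrite !expr0 !mulr1; exact: le_trans.
move=> x; apply/cvgrPdist_lt => d d0; pose K := C / (1 - q) + 1.
have K0 : 0 < K by rewrite ltr_wpDl// divr_ge0// subr_ge0 ltW.
have /cvgrPdist_lt/(_ _ (divr_gt0 d0 K0)) : y @[y --> x] --> x := cvg_id.
apply: filterS => y xy.
have -> : op_series e x - op_series e y = op_series e (x - y).
  rewrite (_ : x - y = (-1) *: y + x); last by rewrite scaleN1r addrC.
  by rewrite op_seriesP scaleN1r addrC.
apply: (@le_lt_trans _ _ (K * `|x - y|)).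
  by apply: le_trans (op_series_le _) _; rewrite ler_wpM2r// lerDl.
by rewrite mulrC -ltr_pdivlMr.
Qed.

End summable_coefficients.

(** Splits off the term of index 0 and absorbs one M into the argument, so that a recurrence between
    coefficients becomes an identity between operators. *)
Lemma op_series_shift (e u : nat -> R) (C q : R) x : 0 <= q -> q < 1 ->
  (forall n, `|e n| * L ^+ n <= C * q ^+ n) -> (forall n, u n.+1 = e n) ->
  series (fun n => u n *: iter n M x) @ \oo --> u 0 *: x + op_series e (M x).
Proof.
move=> q0 q1 he ue; rewrite -cvg_shiftS.
rewrite (_ : [sequence _]_n =
    (fun n => u 0 *: x + series (fun n => e n *: iter n M (M x)) n)).
  by apply: cvgD; [exact: cvg_cst|exact: op_series_cvg he _].
apply/funext => n; rewrite /series/= big_nat_recl//=; congr (_ + _).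
by apply: eq_bigr => i _; rewrite ue -iterS iterSr.
Qed.

Lemma ReM (x y : R[i]) : complex.Re (x * y) =
  complex.Re x * complex.Re y - complex.Im x * complex.Im y.
Proof. by case: x y => [a b] [c d]. Qed.

Lemma ImM (x y : R[i]) : complex.Im (x * y) =
  complex.Re x * complex.Im y + complex.Im x * complex.Re y.
Proof. by case: x y => [a b] [c d]. Qed.

Lemma normc_ge_Re_Im (x : R[i]) :
  `|complex.Re x| <= Normc.normc x /\ `|complex.Im x| <= Normc.normc x.
Proof.
case: x => [a b] /=; rewrite -!sqrtr_sqr; split; apply: ler_wsqrtr.
  by rewrite lerDl sqr_ge0.
by rewrite lerDr sqr_ge0.
Qed.

Lemma normcX (x : R[i]) n : Normc.normc (x ^+ n) = Normc.normc x ^+ n.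
Proof. by elim: n => [|n ih]; rewrite ?Normc.normc1// !exprS Normc.normcM ih. Qed.

(* The inverse of M - l is minus the sum of the l^-(n+1) M^n, whose real and
   imaginary parts are the operators P and Q below. *)
Lemma spectrum_normc_le (l : R[i]) : spectrum M l -> Normc.normc l <= L.
Proof.
move=> Ml; rewrite leNgt; apply/negP => Ll; apply: Ml.
have nl0 : 0 < Normc.normc l by exact: le_lt_trans Ll.
have l0 : l != 0 by apply: contraTneq nl0 => ->; rewrite Normc.normc0 ltxx.
pose z := l^-1; pose s := Normc.normc z.
have sE : s = (Normc.normc l)^-1 by exact: Normc.normcV.
have s0 : 0 <= s by rewrite sE invr_ge0 ltW.
pose c n := complex.Re (z ^+ n.+1); pose d n := complex.Im (z ^+ n.+1).
have q0 : 0 <= s * L by rewrite mulr_ge0.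
have q1 : s * L < 1 by rewrite sE mulrC ltr_pdivrMr// mul1r.
have cd_le n : `|c n| * L ^+ n <= s * (s * L) ^+ n /\
    `|d n| * L ^+ n <= s * (s * L) ^+ n.
  have [h1 h2] := normc_ge_Re_Im (z ^+ n.+1).
  by rewrite exprMn mulrA -exprS /s -normcX !ler_wpM2r ?exprn_ge0.
have c_le n := (cd_le n).1; have d_le n := (cd_le n).2.
set a := complex.Re l; set b := complex.Im l.
pose P := op_series c; pose Q := op_series d.
have zl n : z ^+ n.+1 * l = z ^+ n by rewrite exprSr -mulrA mulVf// mulr1.
(* [PQ1] and [PQ2] are the real and imaginary parts of l (P + iQ) x = x + (P + iQ) (M x), which
   comes from l^-(n+1) l = l^-n. *)
have PQ1 x : a *: P x - b *: Q x = x + P (M x).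
  apply: (cvg_unique _ (F := series (fun n => (a * c n - b * d n) *: iter n M x) @ \oo)) => //.
    rewrite (_ : series _ = (fun n => a *: series (fun n => c n *: iter n M x) n -
        b *: series (fun n => d n *: iter n M x) n)); last first.
      apply/funext => n; rewrite /series/= !scaler_sumr -sumrB.
      by apply: eq_bigr => i _; rewrite scalerBl !scalerA.
    apply: cvgB; apply: cvgZr; exact: op_series_cvg q0 q1 _ _.
  have -> : x + P (M x) = (a * c 0%N - b * d 0%N) *: x + P (M x).
    by rewrite (_ : _ - _ = 1) ?scale1r// mulrC (mulrC b) -ReM zl expr0.
  apply: (@op_series_shift c (fun n => a * c n - b * d n) _ _ x q0 q1 c_le) => n.
  by rewrite mulrC (mulrC b) -ReM zl.
have PQ2 x : a *: Q x + b *: P x = Q (M x).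
  apply: (cvg_unique _ (F := series (fun n => (a * d n + b * c n) *: iter n M x) @ \oo)) => //.
    rewrite (_ : series _ = (fun n => a *: series (fun n => d n *: iter n M x) n +
        b *: series (fun n => c n *: iter n M x) n)); last first.
      apply/funext => n; rewrite /series/= !scaler_sumr -big_split/=.
      by apply: eq_bigr => i _; rewrite scalerDl !scalerA.
    apply: cvgD; apply: cvgZr; exact: op_series_cvg q0 q1 _ _.
  have -> : Q (M x) = (a * d 0%N + b * c 0%N) *: x + Q (M x).
    rewrite (_ : _ + b * _ = 0) ?scale0r ?add0r//.
    by rewrite mulrC (mulrC b) addrC -ImM zl expr0.
  apply: (@op_series_shift d (fun n => a * d n + b * c n) _ _ x q0 q1 d_le) => n.
  by rewrite mulrC (mulrC b) addrC -ImM zl.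
have PP e x y : P (e *: x + y) = e *: P x + P y by exact: op_seriesP c_le _ _ _.
have QP e x y : Q (e *: x + y) = e *: Q x + Q y by exact: op_seriesP d_le _ _ _.
have PMx x : P (M x) = a *: P x - b *: Q x - x by rewrite PQ1 addrC addKr.
have QMx x : Q (M x) = a *: Q x + b *: P x by rewrite PQ2.
have P0 : P 0 = 0.
  by apply: (@addrI _ (P 0)); rewrite addr0 -{3}[0]addr0 -{3}[0](scale1r 0) PP scale1r.
have PD x y : P (x + y) = P x + P y by have := PP 1 x y; rewrite !scale1r.
have Q0 : Q 0 = 0.
  by apply: (@addrI _ (Q 0)); rewrite addr0 -{3}[0]addr0 -{3}[0](scale1r 0) QP scale1r.
have QD x y : Q (x + y) = Q x + Q y by have := QP 1 x y; rewrite !scale1r.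
have PZ e x : P (e *: x) = e *: P x by have := PP e x 0; rewrite P0 !addr0.
have QZ e x : Q (e *: x) = e *: Q x by have := QP e x 0; rewrite Q0 !addr0.
have PN x : P (- x) = - P x by rewrite -scaleN1r PZ scaleN1r.
have QN x : Q (- x) = - Q x by rewrite -scaleN1r QZ scaleN1r.
have cP : continuous P by exact: op_series_continuous q0 q1 c_le.
have cQ : continuous Q by exact: op_series_continuous q0 q1 d_le.
(* This is -(P + iQ) applied to x.1 + i x.2. *)
exists (fun x => (- (P x.1 - Q x.2), - (P x.2 + Q x.1))); split.
- move=> x; apply: cvg_pair => /=; apply: cvgN.
    by apply: cvgB; apply: continuous_cvg;
      [exact: cP|exact: cvg_fst|exact: cQ|exact: cvg_snd].
  by apply: cvgD; apply: continuous_cvg;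
    [exact: cP|exact: cvg_snd|exact: cQ|exact: cvg_fst].
- move=> [x y]; rewrite /sub_scalar/= -/a -/b.
  rewrite !(PD, QD, PN, QN, PZ, QZ, PMx, QMx).
  have [-> _ _ _] := resolvent_identities (a *: P x) (b *: Q x) (b *: P y) (a *: Q y) x.
  have [_ -> _ _] := resolvent_identities (a *: P y) (b *: Q y) (b *: P x) (a *: Q x) y.
  by rewrite !opprK.
- move=> [x y]; rewrite /sub_scalar/= -/a -/b !(scalerDr, scalerN).
  have MN u : M (- u) = - M u by exact: raddfN.
  have MB u v : M (u - v) = M u - M v by exact: raddfB.
  have MD u v : M (u + v) = M u + M v by exact: raddfD.
  have MP z' : M (P z') = P (M z') by exact: op_series_comm c_le _.
  have MQ z' : M (Q z') = Q (M z') by exact: op_series_comm d_le _.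
  rewrite !MN MB MD !(MP, MQ, PMx, QMx) -!opprD.
  have [_ _ -> _] := resolvent_identities (a *: P x) (b *: Q x) (b *: P y) (a *: Q y) x.
  have [_ _ _ ->] := resolvent_identities (a *: P y) (b *: Q y) (b *: P x) (a *: Q x) y.
  by rewrite !opprK.
Qed.

End operator_series.

(** * Spectral radius and quasi-compactness *)

Section substitution_operator.
Context (R : realType) (A : topologicalType) (cA : compact [set: A]).
Context (rho : continuousType A (nword A)).
Local Notation E := (contfun R cA).
Local Notation W n a := (iter n (subst_word rho) [:: a]).
Local Notation M := (subst_op R cA rho).
Variables (L : nat) (a0 : A).
Hypothesis size_rho : forall a, size (subst_letter rho a) = L.
Hypothesis L_gt1 : (1 < L)%N.

Let one : E := mk_contfun cA (@cst_continuous A R 1).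

Lemma subst_opE (f : E) a : M f a = \sum_(b <- subst_letter rho a) f b.
Proof. by []. Qed.

Lemma iter_subst_opE n (f : E) a : iter n M f a = \sum_(b <- W n a) f b.
Proof.
elim: n a => [|n ih] a; first by rewrite big_seq1.
rewrite iterS subst_opE -addn1 iter_subst_wordD big_flatten big_map/=.
by rewrite /subst_word/= cats0; apply: eq_bigr => b _; exact: ih.
Qed.

Lemma subst_op_le (f : E) : `|M f| <= L%:R * `|f|.
Proof.
apply: supnorm_le => [|a]; first by rewrite mulr_ge0.
rewrite subst_opE; apply: le_trans (ler_norm_sum _ _ _) _.
apply: (@le_trans _ _ (\sum_(b <- subst_letter rho a) `|f|)).
  by apply: ler_sum => b _; exact: (supnorm_ge f).
by rewrite big_const_seq count_predT size_rho iter_addr_0 mulr_natl.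
Qed.

(** The norm bound puts the spectrum in the disc of radius L, and the constant function 1 is an
    eigenvector for L, nonzero because it takes the value 1 at a0. *)
Lemma spectral_radius_subst_op : spectral_radius M = L%:R.
Proof.
have ub l : spectrum M l -> Normc.normc l <= L%:R.
  exact: (spectrum_normc_le (ler0n R L) subst_op_le).
have ML : spectrum M (L%:R%:C)%C.
  move=> [S [_ SK _]].
  have M1 : M one = L%:R *: one.
    apply: contfunP => a; rewrite subst_opE contfunZE /=.
    by rewrite big_const_seq count_predT size_rho iter_addr_0 mulr1.
  have : (one, 0 : E) = (0, 0).
    apply: (can_inj SK); rewrite /sub_scalar/= M1 !scale0r !scaler0 !subr0 subrr.
    by rewrite linear0 !addr0 subr0.
  move=> /(congr1 (fun q : E * E => q.1 a0)) /= /eqP.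
  by rewrite -[X in is_true X -> _]/((1 : R) == 0) oner_eq0.
apply/eqP; rewrite eq_le; apply/andP; split.
  by apply: ge_sup; [eexists; exists (L%:R%:C)%C|move=> _ [l /ub ? <-]].
apply: ub_le_sup; first by exists L%:R => _ [l /ub ? <-].
exists (L%:R%:C)%C => //=.
by rewrite expr0n addr0 sqrtr_sqr ger0_norm.
Qed.

(** A rank one operator; with c = L^-p it is the compact part of T^p. *)
Definition evaluation (c : R) (f : E) : E := (c * f a0) *: one.

Lemma evaluation_linear (c : R) : linear (evaluation c).
Proof.
move=> d f g; rewrite /evaluation scalerA -scalerDl; congr (_ *: _).
by rewrite contfunDE contfunZE; lra.
Qed.

HB.instance Definition _ (c : R) := GRing.isLinear.Build R E E *:%R
  (evaluation c) (evaluation_linear c).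

(** The unit ball is sent into a segment of constant functions, compact as the image of a real
    interval. *)
Lemma evaluation_compact (c : R) :
  compact_operator (evaluation c).
Proof.
pose K := [set t *: one | t in `[- `|c|, `|c|]%classic].
apply: (@precompact_subset _ _ K).
  move=> _ [f /= f1 <-]; exists (c * f a0) => //=.
  rewrite in_itv/= -ler_norml normrM ler_piMr//.
  exact: le_trans (supnorm_ge f a0) f1.
apply: compact_precompact; first exact: norm_hausdorff.
apply: continuous_compact; last exact: segment_compact.
by apply: continuous_subspaceT => t; apply: cvgZl; exact: cvg_id.
Qed.

Lemma quasi_compact_subst_op (p : nat) : (0 < p)%N ->
  (forall a, a0 \in W p a) -> quasi_compact (L%:R^-1 \*: M).
Proof.
move=> p0 a0_in; pose c : R := L%:R^-1 ^+ p.
have iterT n (f : E) : iter n (L%:R^-1 \*: M) f = L%:R^-1 ^+ n *: iter n M f.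
  elim: n => [|n ih]; first by rewrite expr0 scale1r.
  by rewrite !iterS ih /= linearZ/= scalerA exprS.
exists (evaluation c), p; split=> //.
  exact: evaluation_compact.
have c0 : 0 < c by rewrite exprn_gt0// invr_gt0 ltr0n ltnW.
have cL : c * (L ^ p)%:R = 1.
  by rewrite natrX -exprMn mulVf ?expr1n// pnatr_eq0 -lt0n ltnW.
apply: (@le_lt_trans _ _ (1 - c)); last by rewrite ltrBlDr ltrDl.
have c1 : 0 <= 1 - c.
  by rewrite subr_ge0 exprn_ile1// ?invr_ge0// invf_le1 ?ltr0n ?ler1n ltnW.
apply: ge_sup.
  exists `|iter p (L%:R^-1 \*: M) 0 - evaluation c 0|, 0 => //.
  by rewrite /unit_ball/= normr0.
move=> _ [f /= f1 <-]; apply: supnorm_le => // a.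
rewrite -[X in `|X|]/(iter p (L%:R^-1 \*: M) f a - (c * f a0) * 1).
rewrite iterT contfunZE iter_subst_opE mulr1 -/c -mulrBr.
(* One occurrence of a0 in rho^p(a) cancels against the evaluation. The L^p - 1 remaining letters
   contribute at most 1 each, with weight c = L^-p, hence the bound 1 - c. *)
rewrite (big_rem _ (a0_in a))/= addrC addrK normrM gtr0_norm//.
have sz : size (rem a0 (W p a)) = (L ^ p - 1)%N.
  by rewrite size_rem// (size_iter_subst_word size_rho) subn1.
apply: (@le_trans _ _ (c * (L ^ p - 1)%:R)).
  rewrite (ler_wpM2l (ltW c0))//; apply: le_trans (ler_norm_sum _ _ _) _.
  apply: (@le_trans _ _ (\sum_(b <- rem a0 (W p a)) 1)).
    by apply: ler_sum => b _; exact: (le_trans (supnorm_ge f b) (f1 : supnorm f <= 1)).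
  by rewrite big_const_seq count_predT iter_addr_0 sz.
have Lp_gt0 : (0 < L ^ p)%N by rewrite expn_gt0 ltnW.
by rewrite (natrB _ Lp_gt0) mulrBr mulr1 cL.
Qed.

End substitution_operator.

(** Primitivity for the open set {a0} may return the exponent 0, whereas quasi-compactness asks for
    a positive power. The next exponent works too: rho^(p+1)(a) is made of the words rho^p(b) for b
    in the non-empty word rho(a). *)
Lemma primitive_return (A : topologicalType) (rho : continuousType A (nword A)) (a0 : A) :
  primitive rho -> isolated [set: A] a0 ->
  exists2 p, (0 < p)%N & forall a, a0 \in iter p (subst_word rho) [:: a].
Proof.
move=> prim [_ [V V0]]; rewrite setIT => VE; rewrite VE in V0.
have [p hp] : exists p : nat, forall a, exists2 b,
    b \in iter p (subst_word rho) [:: a] & [set a0] b.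
  apply: prim; last by exists a0.
  by rewrite openE => _ ->.
have a0_in a : a0 \in iter p (subst_word rho) [:: a] by have [b bW <-] := hp a.
exists p.+1 => // a; rewrite -addn1 iter_subst_wordD.
have [b ba] : exists b, b \in iter 1 (subst_word rho) [:: a].
  rewrite /= /subst_word/= cats0 /subst_letter; case: (rho a) => n w.
  by exists (w ord0); apply/mapP; exists ord0; rewrite ?mem_enum.
apply/flattenP; exists (iter p (subst_word rho) [:: b]) => //.
exact: map_f.
Qed.

Theorem mainTheorem6 (R : realType) (A : topologicalType)
    (cA : compact [set: A]) (hA : hausdorff_space A)
    (rho : continuousType A (nword A)) :
  growing rho -> primitive rho -> constant_length rho ->
  (exists a : A, isolated [set: A] a) ->
  let M : {linear contfun R cA -> contfun R cA} := subst_op R cA rho in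
  let r : R := spectral_radius M in
  let T : {linear contfun R cA -> contfun R cA} := r^-1 \*: M in
  quasi_compact T /\ uniquely_ergodic R (@subshift_map A rho).
Proof.
move=> grow prim constL [a0 ia0] M r T.
have [p p0 a0_in] := primitive_return prim ia0.
have size_rho a : size (subst_letter rho a) = size (subst_letter rho a0).
  exact: constL.
have L_gt1 : (1 < size (subst_letter rho a0))%N.
  by have [b b2] := grow; rewrite (constL a0 b).
split; last exact: subshift_uniquely_ergodic cA hA grow constL a0_in.
rewrite /T /r (spectral_radius_subst_op R cA a0 size_rho).
exact: (quasi_compact_subst_op R cA size_rho L_gt1 p0 a0_in).
Qed.
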